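(* There is an isomorphism of complex vector spaces $\sigma:\mathbf{F}\to\mathbf{B}$ given by $$\sigma(|\lambda,h\rangle)=q^h\chi_\lambda(x_1,x_2,\ldots)$$ for every charged partition $(\lambda,h)$. It restricts to an isomorphism $\mathbf{F}^{(h)}\to\mathbf{B}^{(h)}$ for all $h\in\mathbb{Z}$.
   Context: A charged partition is a pair $(\lambda,h)$ consisting of an integer partition $\lambda$ and an integer $h$ (the charge). Fermionic Fock space $\mathbf{F}$ is the $\mathbb{C}$-vector space with basis $\{|\lambda,h\rangle\}$ indexed by all charged partitions, and $\mathbf{F}^{(h)}$ is the span of the $|\lambda,h\rangle$ with charge $h$. Bosonic Fock space is $\mathbf{B}=\mathbb{C}[x_1,x_2,x_3,\ldots;q,q^{-1}]$ (polynomial in the $x_k$, Laurent polynomial in $q$), and $\mathbf{B}^{(h)}=q^h\,\mathbb{C}[x_1,x_2,\ldots]$. A column-strict filling of $\lambda$ is a function $t$ from the boxes of the diagram of $\lambda$ to $\mathbb{Z}_{>0}$ that is weakly increasing along rows and strictly increasing along columns. The Schur symmetric function in variables $y_1,y_2,\ldots$ is $s_\lambda=\sum_t\prod_{b}y_{t(b)}$, the sum over all column-strict fillings $t$ of $\lambda$ and the product over all boxes $b$ of $\lambda$. For $k\in\mathbb{Z}_{>0}$, $p_k=y_1^k+y_2^k+\cdots$ is the power sum symmetric function. The character polynomial $\chi_\lambda\in\mathbb{C}[x_1,x_2,\ldots]$ is the unique polynomial such that $\chi_\lambda(p_1,\tfrac12p_2,\tfrac13p_3,\ldots)=s_\lambda$.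 *)

(* Defs.v *)
From HB Require Import structures.
From mathcomp Require Import all_boot all_order all_algebra finmap.
From mathcomp Require Import boolp classical_sets functions cardinality fsbigop.
From mathcomp Require Import reals complex.
From mathcomp Require Import monalg.

Set Implicit Arguments.
Unset Strict Implicit.
Unset Printing Implicit Defensive.

Import Order.TTheory GRing.Theory Num.Theory.

Local Open Scope classical_set_scope.
Local Open Scope ring_scope.

(** Everything infinite is indexed from 0: index [i] of a monomial in
    [{cmonom nat}] stands for the variable [x_(i+1)] or [y_(i+1)]. *)

(** * Formal power series in y_1, y_2, ... *)

Record fps (R : Type) := Fps { fps_coef : {cmonom nat} -> R }.

Section FpsRing.
Variable R : comNzRingType.
Local Notation M := {cmonom nat}.
Local Notation S := (fps R).
Implicit Types (f g : S) (m : M).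

Lemma fpsP f g : (forall m, fps_coef f m = fps_coef g m) -> f = g.
Proof. by case: f g => [f] [g] /= fg; congr Fps; apply: funext. Qed.

HB.instance Definition _ := gen_eqMixin S.
HB.instance Definition _ := gen_choiceMixin S.

Definition fps0 : S := Fps (fun _ => 0).
Definition fps_opp f : S := Fps (fun m => - fps_coef f m).
Definition fps_add f g : S := Fps (fun m => fps_coef f m + fps_coef g m).

Fact fps_addA : associative fps_add.
Proof. by move=> f g h; apply: fpsP => m /=; rewrite addrA. Qed.
Fact fps_addC : commutative fps_add.
Proof. by move=> f g; apply: fpsP => m /=; rewrite addrC. Qed.
Fact fps_add0 : left_id fps0 fps_add.
Proof. by move=> f; apply: fpsP => m /=; rewrite add0r. Qed.
Fact fps_addN : left_inverse fps0 fps_opp fps_add.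
Proof. by move=> f; apply: fpsP => m /=; rewrite addNr. Qed.

HB.instance Definition _ :=
  GRing.isZmodule.Build S fps_addA fps_addC fps_add0 fps_addN.

Definition fps_one : S := Fps (fun m => (m == mone)%:R).

Definition factorizations m : set (M * M) := [set p | mmul p.1 p.2 = m].

Definition fps_mul f g : S :=
  Fps (fun m => \sum_(p \in factorizations m)
                  fps_coef f p.1 * fps_coef g p.2).

Lemma finite_factorizations m : finite_set (factorizations m).
Proof.
pose T := {ffun finsupp m -> 'I_(mdeg m).+1}.
pose mk (t : T) : M := mkcmonom
  [fsfun i in finsupp m => (if insub i is Some j then t j : nat else 0%N) | 0%N].
have mkP (k : M) : (forall i, (k i <= m i)%N) -> exists t, mk t = k.
  move=> km; exists [ffun i => inord (k (val i))].
  apply/eqP/cmP => i; rewrite cmE fsfun_fun.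
  case: ifPn => [im|]; last first.
    by rewrite memNfinsupp => /eqP mi; have := km i; rewrite mi leqn0 => /eqP.
  rewrite insubT /= ffunE inordK // ltnS (leq_trans (km i)) //.
  by rewrite mdegE (big_fsetD1 i) //= leq_addr.
apply: (@sub_finite_set _ _ [set (mk p.1, mk p.2) | p in [set: T * T]]).
  move=> [k1 k2] /= km.
  have [i|t1 t1E] := mkP k1; first by rewrite -km cmM leq_addr.
  have [i|t2 t2E] := mkP k2; first by rewrite -km cmM leq_addl.
  by exists (t1, t2); rewrite //= t1E t2E.
exact/finite_image/finite_finset.
Qed.

Definition cm_divisors m : {fset M} := fset_set (fst @` factorizations m).

Lemma cm_divisorsP m k : reflect (exists k', mmul k k' = m) (k \in cm_divisors m).
Proof.
rewrite in_fset_set; last exact/finite_image/finite_factorizations.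
apply: (iffP idP) => [/set_mem[[a b] /= <- <-]|[k' <-]]; first by exists b.
by apply/mem_set; exists (k, k').
Qed.

Lemma fps_mulE m (D : {fset M}) f g : (cm_divisors m `<=` D)%fset ->
  fps_coef (fps_mul f g) m =
  \sum_(a <- D) \sum_(b <- D)
    (fps_coef f a * fps_coef g b) *+ (mmul a b == m).
Proof.
move=> /fsubsetP mD.
pose G (p : M * M) := fps_coef f p.1 * fps_coef g p.2.
transitivity (\sum_(p <- [seq (a, b) | a <- D, b <- D] | mmul p.1 p.2 == m) G p).
  rewrite bigfs /=; first by apply: eq_fsbigl; apply/seteqP; split => p /= /eqP.
    by apply: allpairs_uniq; rewrite ?fset_uniq // => -[? ?] [? ?].
  move=> [a b] /= /eqP abm /negP[]; apply/allpairsP; exists (a, b) => /=.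
  by split => //; apply/mD/cm_divisorsP; [exists b|exists a; rewrite mulmC].
rewrite big_mkcond big_allpairs; apply: eq_bigr => a _.
by apply: eq_bigr => b _; rewrite mulrb.
Qed.

Lemma cm_divisorsM m a b : mmul a b \in cm_divisors m ->
  a \in cm_divisors m /\ b \in cm_divisors m.
Proof.
move=> /cm_divisorsP[c abc]; split; apply/cm_divisorsP.
  by exists (mmul b c); rewrite mulmA.
by exists (mmul a c); rewrite mulmA [mmul b a]mulmC.
Qed.

Fact fps_mulC : commutative fps_mul.
Proof.
move=> f g; apply: fpsP => m; rewrite !(@fps_mulE _ (cm_divisors m)) //.
rewrite exchange_big; apply: eq_bigr => a _; apply: eq_bigr => b _ /=.
by rewrite mulrC mulmC.
Qed.

Fact fps_mul1 : left_id fps_one fps_mul.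
Proof.
move=> f; apply: fpsP => m; rewrite (@fps_mulE _ (cm_divisors m)) //=.
have m1 : mone \in cm_divisors m by apply/cm_divisorsP; exists m; rewrite mul1m.
have mm : m \in cm_divisors m by apply/cm_divisorsP; exists mone; rewrite mulm1.
rewrite (big_fsetD1 _ m1) /= [X in _ + X]big1_fset ?addr0; last first.
  move=> a; rewrite in_fsetD1 => /andP[/negPf a1 _] _.
  by apply: big1 => b _; rewrite a1 mul0r mul0rn.
rewrite (big_fsetD1 _ mm) /= [X in _ + X]big1_fset ?addr0; last first.
  by move=> b; rewrite in_fsetD1 => /andP[/negPf bm _] _; rewrite mul1m bm.
by rewrite mul1m !eqxx mul1r.
Qed.

Fact fps_mulDl : left_distributive fps_mul fps_add.
Proof.
move=> f g h; apply: fpsP => m.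
change (fps_coef (fps_mul (fps_add f g) h) m =
  fps_coef (fps_mul f h) m + fps_coef (fps_mul g h) m).
rewrite !(@fps_mulE _ (cm_divisors m)) // -big_split; apply: eq_bigr => a _ /=.
by rewrite -big_split; apply: eq_bigr => b _ /=; rewrite mulrDl mulrnDl.
Qed.

(* The common expansion of [(f * g) * h] and [f * (g * h)]. *)
Let fps_mul3 f g h m := \sum_(a <- cm_divisors m) \sum_(b <- cm_divisors m)
  \sum_(c <- cm_divisors m)
    (fps_coef f a * fps_coef g b * fps_coef h c) *+ (mmul (mmul a b) c == m).

Let fps_mul3E f g h m :
  fps_coef (fps_mul (fps_mul f g) h) m = fps_mul3 f g h m.
Proof.
rewrite (@fps_mulE _ (cm_divisors m)) //.
transitivity (\sum_(e <- cm_divisors m) \sum_(c <- cm_divisors m)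
   \sum_(a <- cm_divisors m) \sum_(b <- cm_divisors m)
    (fps_coef f a * fps_coef g b * fps_coef h c)
      *+ ((mmul e c == m) && (mmul a b == e))).
  rewrite !big_seq; apply: eq_bigr => e em; apply: eq_bigr => c _.
  rewrite (@fps_mulE _ (cm_divisors m)); last first.
    apply/fsubsetP => a /cm_divisorsP[b abe]; apply: (proj1 (@cm_divisorsM m a b _)).
    by rewrite abe.
  rewrite mulr_suml -sumrMnl; apply: eq_bigr => a _.
  rewrite mulr_suml -sumrMnl; apply: eq_bigr => b _.
  by rewrite mulrnAl -mulrnA mulnb andbC.
under eq_bigr do rewrite exchange_big /=.
rewrite exchange_big /=; apply: eq_bigr => a _.
under eq_bigr do rewrite exchange_big /=.
rewrite exchange_big /=; apply: eq_bigr => b _.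
rewrite exchange_big /=; apply: eq_bigr => c _.
have [abcm|abcm] := eqVneq (mmul (mmul a b) c) m; last first.
  rewrite big1 // => e _; case: (eqVneq (mmul a b) e) => [<-|]; rewrite ?andbF //.
  by rewrite (negPf abcm).
have abD : mmul a b \in cm_divisors m by apply/cm_divisorsP; exists c.
rewrite (big_fsetD1 _ abD) /= abcm !eqxx /= big1_fset ?addr0 // => e.
by rewrite in_fsetD1 eq_sym => /andP[/negPf ->]; rewrite andbF.
Qed.

Fact fps_mulA : associative fps_mul.
Proof.
move=> f g h; rewrite [LHS]fps_mulC; apply: fpsP => m; rewrite !fps_mul3E.
rewrite /fps_mul3 [RHS]exchange_big /=; apply: eq_bigr => b _.
rewrite [RHS]exchange_big /=; apply: eq_bigr => c _; apply: eq_bigr => a _.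
by rewrite mulrC mulrA [mmul (mmul b c) a]mulmC mulmA.
Qed.

Fact fps_one_neq0 : fps_one != fps0.
Proof.
apply/eqP => /(congr1 (fun f => fps_coef f mone)) /= /eqP.
by rewrite eqxx oner_eq0.
Qed.

HB.instance Definition _ := GRing.Zmodule_isComNzRing.Build S
  fps_mulA fps_mulC fps_mul1 fps_mulDl fps_one_neq0.

Definition fps_scale (c : R) f : S := Fps (fun m => c * fps_coef f m).

Fact fps_scaleA a b f : fps_scale a (fps_scale b f) = fps_scale (a * b) f.
Proof. by apply: fpsP => m /=; rewrite mulrA. Qed.
Fact fps_scale1 : left_id 1 fps_scale.
Proof. by move=> f; apply: fpsP => m /=; rewrite mul1r. Qed.
Fact fps_scaleDr : right_distributive fps_scale +%R.
Proof. by move=> a f g; apply: fpsP => m /=; rewrite mulrDr. Qed.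
Fact fps_scaleDl f : {morph fps_scale^~ f : a b / a + b}.
Proof. by move=> a b; apply: fpsP => m /=; rewrite mulrDl. Qed.

HB.instance Definition _ := GRing.Zmodule_isLmodule.Build R S
  fps_scaleA fps_scale1 fps_scaleDr fps_scaleDl.

Fact fps_scaleAl (c : R) f g : c *: (f * g) = c *: f * g.
Proof.
apply: fpsP => m.
change (c * fps_coef (fps_mul f g) m = fps_coef (fps_mul (fps_scale c f) g) m).
rewrite !(@fps_mulE _ (cm_divisors m)) // mulr_sumr; apply: eq_bigr => a _.
by rewrite mulr_sumr; apply: eq_bigr => b _ /=; rewrite mulrnAr mulrA.
Qed.

HB.instance Definition _ := GRing.Lmodule_isLalgebra.Build R S fps_scaleAl.
HB.instance Definition _ := GRing.Lalgebra_isComAlgebra.Build R S.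

End FpsRing.

(** The formal sum of the monomials [wt t], for [t] in [A].  It is meaningful
    when each monomial is the weight of finitely many [t] in [A] (the
    finitely-supported sum is 0 by convention otherwise). *)
Definition monomial_sum (R : comNzRingType) (T : choiceType) (A : set T)
    (wt : T -> {cmonom nat}) : fps R :=
  Fps (fun m => \sum_(t \in A `&` wt @^-1` [set m]) (1 : R)).

(** * Schur functions *)

Definition is_partition (s : seq nat) := sorted geq s && (0%N \notin s).

Record intpart := IntPart
  { parts :> seq nat; partsP : is_partition parts }.

HB.instance Definition _ := [isSub for parts].
HB.instance Definition _ := [Choice of intpart by <:].

(* Rows and columns of the diagram are counted from 0. *)
Definition box (l : intpart) := {i : 'I_(size l) & 'I_(nth 0%N l i)}.
Definition box_row (l : intpart) (b : box l) : nat := tag b.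
Definition box_col (l : intpart) (b : box l) : nat := tagged b.

(* The value [i] of a filling stands for the positive integer [i.+1]. *)
Definition filling (l : intpart) := {ffun box l -> nat}.

Definition column_strict (l : intpart) (t : filling l) : Prop :=
  (forall b c : box l, box_row b = box_row c ->
     (box_col b <= box_col c)%N -> (t b <= t c)%N) /\
  (forall b c : box l, box_col b = box_col c ->
     (box_row b < box_row c)%N -> (t b < t c)%N).

Definition filling_weight (l : intpart) (t : filling l) : {cmonom nat} :=
  \big[mmul/mone]_(b : box l) ucm (t b).

Definition schur (R : comNzRingType) (l : intpart) : fps R :=
  monomial_sum R [set t | column_strict t] (@filling_weight l).

Lemma schur_finite (l : intpart) (m : {cmonom nat}) :
  finite_set ([set t : filling l | column_strict t] `&`
              (@filling_weight l) @^-1` [set m]).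
Proof.
pose T := {ffun box l -> finsupp m}.
apply: (@sub_finite_set _ _ [set [ffun b => val (t b)] | t in [set: T]]).
  move=> t [_ /= tm].
  have tP b : t b \in finsupp m.
    by rewrite -cmE_neq0 -tm /filling_weight (bigD1 b) //= cmM cmUU.
  exists [ffun b => [` tP b]%fset] => //.
  by apply/ffunP => b; rewrite !ffunE.
exact/finite_image/finite_finset.
Qed.

(** * Character polynomials *)

(* [power_sum R k] is y_1^k + y_2^k + ...; only used for k > 0. *)
Definition power_sum (R : comNzRingType) (k : nat) : fps R :=
  monomial_sum R [set: nat] (fun i => expcmn (ucm i) k).

Lemma expcmnE (I : choiceType) (m : {cmonom I}) n i :
  expcmn m n i = (n * m i)%N.
Proof.
have -> : expcmn m n = iter n (mulcm m) (onecm I).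
  by case: n => //; elim=> [|n IH] /=; [rewrite mulcm0|rewrite -[in RHS]iterS -IH].
by elim: n => [|n IH] /=; rewrite ?onecmE ?mulcmE ?IH.
Qed.

Lemma power_sum_finite (k : nat) (m : {cmonom nat}) : (0 < k)%N ->
  finite_set ([set: nat] `&` (fun i => expcmn (ucm i) k) @^-1` [set m]).
Proof.
move=> k0; apply: (@sub_finite_set _ _ [set` finsupp m]) => // i [_ /= <-].
by rewrite -cmE_neq0 expcmnE ucmE eqxx muln1 -lt0n.
Qed.

(* R[x_1, x_2, ...] *)
Definition xpoly (R : comNzRingType) := {malg R[{cmonom nat}]}.

(* [subst_poly u P] is [P(u 0, u 1, ...)], i.e. x_(i+1) is replaced by [u i]. *)
Definition subst_poly (R : comNzRingType) (S : comAlgType R) (u : nat -> S)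
    (P : xpoly R) : S :=
  mmap (in_alg S)
    (fun m : {cmonom nat} => \prod_(i <- finsupp m) u i ^+ m i) P.

Definition is_character_poly (F : fieldType) (l : intpart) (P : xpoly F) :=
  subst_poly (fun i => (i.+1%:R^-1 : F) *: power_sum F i.+1) P = schur F l.

(* The unique such polynomial (0 if existence or uniqueness were to fail). *)
Definition character_poly (F : fieldType) (l : intpart) : xpoly F :=
  xget 0 [set P | unique (@is_character_poly F l) P].

(** * Bosonic Fock space *)

(** [{malg R[K]}] is a ring only when the monoid [K] has no units besides 1,
    which excludes the Laurent monomials q^h.  [addalg R K] is [{malg R[K]}]
    for an arbitrary commutative monoid [K], written additively. *)
Definition addalg (R : comNzRingType) (K : nmodType) := {malg R[K]}.

Section AddAlg.
Variables (R : comNzRingType) (K : nmodType).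
Local Notation B := (addalg R K).
Implicit Types (k : K) (f g : B).

HB.instance Definition _ := GRing.Lmodule.on B.

Definition addalg_one : B := << 0%R >>.

Definition addalg_mul f g : B := \sum_(k1 <- msupp f) \sum_(k2 <- msupp g)
  << f@_k1 * g@_k2 *g (k1 + k2)%R >>.

Lemma addalg_mulEw (d1 d2 : {fset K}) f g :
  (msupp f `<=` d1)%fset -> (msupp g `<=` d2)%fset ->
  addalg_mul f g = \sum_(k1 <- d1) \sum_(k2 <- d2)
    << f@_k1 * g@_k2 *g (k1 + k2)%R >>.
Proof.
move=> le1 le2; rewrite /addalg_mul (big_fset_incl _ le1) /=.
  apply: eq_bigr => k1 _; apply: big_fset_incl => // k _ /mcoeff_outdom ->.
  by rewrite mulr0 monalgU0.
move=> k _ /mcoeff_outdom fk; apply: big1 => k2 _.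
by rewrite fk mul0r monalgU0.
Qed.

Lemma addalg_mulUU c1 c2 k1 k2 :
  addalg_mul << c1 *g k1 >> << c2 *g k2 >> = << c1 * c2 *g (k1 + k2)%R >>.
Proof.
by rewrite (addalg_mulEw msuppU_le msuppU_le) !big_seq_fset1 !mcoeffUU.
Qed.

Fact addalg_mulC : commutative addalg_mul.
Proof.
move=> f g; rewrite /addalg_mul exchange_big /=; apply: eq_bigr => k1 _.
by apply: eq_bigr => k2 _; rewrite mulrC addrC.
Qed.

Fact addalg_mulDl : left_distributive addalg_mul +%R.
Proof.
move=> f g h; set d := (msupp f `|` msupp g)%fset.
rewrite !(@addalg_mulEw d (msupp h)) ?fsubsetUl ?fsubsetUr ?msuppD_le //.
rewrite -big_split; apply: eq_bigr => k1 _ /=.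
by rewrite -big_split; apply: eq_bigr => k2 _ /=; rewrite mcoeffD mulrDl monalgUD.
Qed.

Let addalg_mulDr : right_distributive addalg_mul +%R.
Proof. by move=> f g h; rewrite !(addalg_mulC f) addalg_mulDl. Qed.

Let addalg_mul0 f : addalg_mul 0 f = 0.
Proof. by rewrite /addalg_mul msupp0 big_seq_fset0. Qed.

Let addalg_mulr0 f : addalg_mul f 0 = 0.
Proof. by rewrite addalg_mulC addalg_mul0. Qed.

Lemma addalg_ind (P : B -> Prop) :
  P 0 -> (forall f g, P f -> P g -> P (f + g)) ->
  (forall c k, P << c *g k >>) -> forall f, P f.
Proof.
move=> P0 PD PU f; rewrite [f]monalgE.
by apply: (big_ind P) => // k _; apply: PU.
Qed.

Fact addalg_mulA : associative addalg_mul.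
Proof.
move=> f g h; elim/addalg_ind: f => [|f1 f2 H1 H2|c1 k1].
- by rewrite !addalg_mul0.
- by rewrite !addalg_mulDl H1 H2.
elim/addalg_ind: g => [|g1 g2 H1 H2|c2 k2].
- by rewrite addalg_mul0 !addalg_mulr0 addalg_mul0.
- by rewrite addalg_mulDl !addalg_mulDr addalg_mulDl H1 H2.
elim/addalg_ind: h => [|h1 h2 H1 H2|c3 k3].
- by rewrite !addalg_mulr0.
- by rewrite !addalg_mulDr H1 H2.
by rewrite !addalg_mulUU mulrA addrA.
Qed.

Fact addalg_mul1 : left_id addalg_one addalg_mul.
Proof.
elim/addalg_ind => [|f1 f2 H1 H2|c k]; first by rewrite addalg_mulr0.
  by rewrite addalg_mulDr H1 H2.
by rewrite addalg_mulUU mul1r add0r.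
Qed.

Fact addalg_one_neq0 : addalg_one != 0.
Proof. by rewrite monalgU_eq0 oner_eq0. Qed.

HB.instance Definition _ := GRing.Zmodule_isComNzRing.Build B
  addalg_mulA addalg_mulC addalg_mul1 addalg_mulDl addalg_one_neq0.

Fact addalg_scaleAl (c : R) f g : c *: (f * g) = c *: f * g.
Proof.
change (c *: addalg_mul f g = addalg_mul (c *: f) g).
rewrite (addalg_mulEw (msuppZ_le c f) (fsubset_refl (msupp g))) /addalg_mul.
rewrite scaler_sumr; apply: eq_bigr => k1 _.
rewrite scaler_sumr; apply: eq_bigr => k2 _.
by apply/malgP => k; rewrite mcoeffZ !mcoeffU mcoeffZ mulrnAr mulrA.
Qed.

HB.instance Definition _ := GRing.Lmodule_isLalgebra.Build R B addalg_scaleAl.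
HB.instance Definition _ := GRing.Lalgebra_isComAlgebra.Build R B.

Lemma addalgUM c1 c2 k1 k2 :
  (<< c1 *g k1 >> : B) * << c2 *g k2 >> = << c1 * c2 *g (k1 + k2)%R >>.
Proof. exact: addalg_mulUU. Qed.

End AddAlg.

HB.instance Definition _ (I : choiceType) := GRing.isNmodule.Build {cmonom I}
  (@mulcmA I) (@mulcmC I) (@mul0cm I).

(* R[x_1, x_2, ...; q, q^-1], with basis the monomials x^m q^h. *)
Definition bosonic (R : comNzRingType) :=
  addalg R ({cmonom nat} * int)%type.

Definition qpow (R : comNzRingType) (h : int) : bosonic R := << (mone, h) >>.

Lemma qpow0 (R : comNzRingType) : qpow R 0 = 1.
Proof. by []. Qed.

Lemma qpowD (R : comNzRingType) (h k : int) :
  qpow R (h + k) = qpow R h * qpow R k.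
Proof.
rewrite /qpow addalgUM mulr1; apply: (congr1 (mkmalgU^~ 1)).
exact/(congr1 (pair^~ _))/esym/(@mul1m {cmonom nat}).
Qed.

Definition bos_x (R : comNzRingType) (i : nat) : bosonic R := << (ucm i, 0) >>.

(* The inclusion of R[x_1, x_2, ...]. *)
Definition of_xpoly (R : comNzRingType) (P : xpoly R) : bosonic R :=
  subst_poly (@bos_x R) P.

(* B^(h) = q^h R[x_1, x_2, ...] *)
Definition bosonic_charge (R : comNzRingType) (h : int) : set (bosonic R) :=
  [set qpow R h * of_xpoly P | P in [set: xpoly R]].

(** * Fermionic Fock space *)

Definition charged_partition : Type := (intpart * int)%type.

Definition fermionic (R : comNzRingType) := {malg R[charged_partition]}.

Definition ket (R : comNzRingType) (l : intpart) (h : int) : fermionic R :=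
  << (l, h) >>.

(* The span of the kets of charge h. *)
Definition fermionic_charge (R : comNzRingType) (h : int) : set (fermionic R) :=
  [set v | exists s : seq (R * intpart),
     v = \sum_(x <- s) x.1 *: ket R x.2 h].

(* Main.v *)
Require Import Defs.
From HB Require Import structures.
From mathcomp Require Import all_boot all_order all_algebra finmap.
From mathcomp Require Import boolp classical_sets functions fsbigop.
From mathcomp Require Import reals complex zify.
From mathcomp Require Import monalg.

Set Implicit Arguments.
Unset Strict Implicit.
Unset Printing Implicit Defensive.

Import Order.TTheory GRing.Theory Num.Theory.
Local Open Scope classical_set_scope.
Local Open Scope ring_scope.

(** Charges only label copies of one and the same map, so everything reduces to
    the charge-free assertion that the character polynomials are a basis of
    C[x_1, x_2, ...].  Let [phi] be the substitution x_k := p_k / k, and for a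
    partition lambda let y^lambda be y_1^(lambda_1) y_2^(lambda_2) ... .

    A symmetric series is determined by its coefficients at the y^lambda.  A
    family (b_lambda) of symmetric series, b_lambda homogeneous of degree
    |lambda|, is called triangular for a rank function [rho] on partitions when
    b_lambda has a nonzero coefficient at y^lambda and its other nonzero
    coefficients at some y^mu have rho(lambda) < rho(mu).  Since there are
    finitely many partitions of each degree, elimination shows that a
    triangular family is linearly independent ([triangular_lift_inj]) and that
    it spans the homogeneous symmetric series ([triangular_lift_surj]).  Two
    families are triangular, for two different ranks.

    - The images under [phi] of the monomials of C[x_1, x_2, ...], that is, up
      to positive factors, the products p_lambda = p_(lambda_1) p_(lambda_2) ...
      ([power_mon_tri], [power_mon_diag]).  A monomial of p_lambda arises by
      choosing a variable for each part; choosing a variable twice lowers the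
      number of variables, and if no variable is chosen twice the exponents are
      the parts of lambda.  The rank is |lambda| minus the number of parts.
      The diagonal coefficients do not vanish because all coefficients are
      nonnegative and choosing y_j for the j-th part contributes.

    - The Schur functions ([schur_tri], [schur_diag]).  In a column-strict
      filling, with entries and rows counted from 0, the entry of a box is at
      least the index of its row.  So the sum of the entries, which can be read
      off the weight, is minimal for one filling only, whose weight is
      y^lambda.  The rank is the minimal sum sum_i (i - 1) lambda_i.  That Schur
      functions are symmetric ([schur_sym]) follows from the Bender-Knuth
      involution, here the reflection of one level of the Gelfand-Tsetlin
      pattern of a filling.

    Triangularity of the first family makes [phi] injective and puts every
    Schur function in its image, so each character polynomial exists and is
    unique.  As [phi] maps the character polynomials to the Schur functions,
    their independence follows from that of the Schur functions; they span
    because the image under [phi] of a monomial is symmetric and homogeneous,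
    hence a combination of Schur functions. *)

(** * Linear maps out of a free module *)

Section Lift.
Variables (F : nzRingType) (K : choiceType) (V : lmodType F) (b : K -> V).

Definition malg_lift (v : {malg F[K]}) : V := \sum_(k <- msupp v) v@_k *: b k.

Lemma malg_liftEw (d : {fset K}) (v : {malg F[K]}) : (msupp v `<=` d)%fset ->
  malg_lift v = \sum_(k <- d) v@_k *: b k.
Proof.
move=> le; rewrite [LHS](big_fset_incl _ le) //= => x _ /mcoeff_outdom ->.
by rewrite scale0r.
Qed.

Fact malg_lift_is_linear : linear malg_lift.
Proof.
move=> a u v; set d := (msupp u `|` msupp v)%fset.
have le_uv : (msupp (a *: u + v) `<=` d)%fset.
  by apply: fsubset_trans (msuppD_le _ _) _; apply: fsetSU; apply: msuppZ_le.
rewrite (malg_liftEw le_uv) (@malg_liftEw d u) ?fsubsetUl //.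
rewrite (@malg_liftEw d v) ?fsubsetUr // scaler_sumr -big_split.
by apply: eq_bigr => k _; rewrite mcoeffD mcoeffZ scalerDl scalerA.
Qed.

HB.instance Definition _ :=
  GRing.isLinear.Build F {malg F[K]} V *:%R malg_lift malg_lift_is_linear.

Lemma malg_liftU c k : malg_lift << c *g k >> = c *: b k.
Proof. by rewrite (malg_liftEw msuppU_le) big_seq_fset1 mcoeffUU. Qed.

Lemma malg_lift1 k : malg_lift << k >> = b k.
Proof. by rewrite malg_liftU scale1r. Qed.

End Lift.

Lemma malgUZ (F : nzRingType) (K : choiceType) (c : F) (k : K) :
  << c *g k >> = c *: << k >>.
Proof. by apply/malgP => j; rewrite mcoeffZ !mcoeffU mulrnAr mulr1. Qed.

Lemma linear_malg_lift (F : nzRingType) (K : choiceType) (V : lmodType F)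
    (f : {linear {malg F[K]} -> V}) v :
  f v = malg_lift (fun k => f << k >>) v.
Proof.
rewrite [in LHS](monalgE v) linear_sum; apply: eq_bigr => k _.
by rewrite malgUZ linearZ.
Qed.

Lemma eq_malg_lift (F : nzRingType) (K : choiceType) (V : lmodType F)
    (b c : K -> V) : b =1 c -> malg_lift b =1 malg_lift c.
Proof. by move=> bc v; apply: eq_bigr => k _; rewrite bc. Qed.

Lemma linear_malg_lift_comp (F : nzRingType) (K : choiceType)
    (V W : lmodType F) (b : K -> V) (f : {linear V -> W}) v :
  f (malg_lift b v) = malg_lift (f \o b) v.
Proof. by rewrite linear_sum; apply: eq_bigr => k _; rewrite linearZ. Qed.

Lemma malg_lift_id (F : nzRingType) (K : choiceType) (v : {malg F[K]}) :
  malg_lift (fun k => << k >>) v = v.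
Proof.
by rewrite [RHS]monalgE; apply: eq_bigr => k _; rewrite -malgUZ.
Qed.

(** * Monomials *)

Local Notation M := {cmonom nat}.

Lemma cm_ext (m1 m2 : M) : (forall i, m1 i = m2 i) -> m1 = m2.
Proof. by move=> /cmP/eqP. Qed.

Lemma cm_bigE (T : Type) (r : seq T) (f : T -> M) j :
  (\big[mmul/mone]_(x <- r) f x) j = (\sum_(x <- r) f x j)%N.
Proof.
by elim: r => [|x r IH]; rewrite ?big_nil ?cm1 // !big_cons cmM IH.
Qed.

Definition nswap (i j : nat) : nat :=
  if j == i then i.+1 else if j == i.+1 then i else j.

Lemma nswapl i : nswap i i = i.+1. Proof. by rewrite /nswap eqxx. Qed.

Lemma nswapr i : nswap i i.+1 = i.
Proof. by rewrite /nswap gtn_eqF // eqxx. Qed.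

Lemma nswap_id i j : j != i -> j != i.+1 -> nswap i j = j.
Proof. by rewrite /nswap => /negPf -> /negPf ->. Qed.

Lemma nswapK i : involutive (nswap i).
Proof.
move=> j; have [->|ji] := eqVneq j i; first by rewrite nswapl nswapr.
have [->|ji1] := eqVneq j i.+1; first by rewrite nswapr nswapl.
by rewrite !nswap_id.
Qed.

Definition cmswap (i : nat) (m : M) : M :=
  mkcmonom [fsfun j in [fset nswap i k | k in finsupp m]%fset =>
              m (nswap i j) | 0%N].

Lemma cmswapE i m j : cmswap i m j = m (nswap i j).
Proof.
rewrite /cmswap cmE fsfun_fun; case: ifPn => // jm; apply/esym/eqP.
rewrite cmE_eq0; apply: contra jm => jm.
by apply/imfsetP; exists (nswap i j); rewrite ?nswapK.
Qed.

Lemma cmswapK i : involutive (cmswap i).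
Proof. by move=> m; apply: cm_ext => j; rewrite !cmswapE nswapK. Qed.

Lemma cmswapM i m1 m2 : cmswap i (mmul m1 m2) = mmul (cmswap i m1) (cmswap i m2).
Proof. by apply: cm_ext => j; rewrite cmswapE !cmM !cmswapE. Qed.

(** * Symmetric and homogeneous power series *)

Section Series.
Variable F : comNzRingType.
Implicit Types f g : fps F.

(** Adjacent transpositions generate all finite permutations of the
    variables. *)
Definition symmetric_fps f :=
  forall i m, fps_coef f (cmswap i m) = fps_coef f m.

Definition homogeneous_fps (d : nat) f :=
  forall m, fps_coef f m != 0 -> mdeg m = d.

Lemma fps_coefM f g m : fps_coef (f * g) m =
  \sum_(p \in factorizations m) fps_coef f p.1 * fps_coef g p.2.
Proof. by []. Qed.

Lemma fps_coefD f g m : fps_coef (f + g) m = fps_coef f m + fps_coef g m.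
Proof. by []. Qed.

Lemma fps_coefZ (c : F) f m : fps_coef (c *: f) m = c * fps_coef f m.
Proof. by []. Qed.

Lemma fps_coef1 m : fps_coef (1 : fps F) m = (m == mone)%:R.
Proof. by []. Qed.

Lemma fps_coef_sum (I : Type) (r : seq I) (f : I -> fps F) m :
  fps_coef (\sum_(i <- r) f i) m = \sum_(i <- r) fps_coef (f i) m.
Proof. by elim: r => [|i r IH]; rewrite ?big_nil // !big_cons fps_coefD IH. Qed.

Lemma fps_coefM_neq0 f g m : fps_coef (f * g) m != 0 ->
  exists m1 m2, [/\ m = mmul m1 m2, fps_coef f m1 != 0 & fps_coef g m2 != 0].
Proof.
move=> fgm; apply: contrapT => no; move/eqP: fgm; apply.
rewrite fps_coefM; apply: fsbig1 => -[m1 m2] /= m12.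
have [->|fm1] := eqVneq (fps_coef f m1) 0; first by rewrite mul0r.
have [->|gm2] := eqVneq (fps_coef g m2) 0; first by rewrite mulr0.
by case: no; exists m1, m2.
Qed.

Lemma symmetric_fps1 : symmetric_fps 1.
Proof.
move=> i m; rewrite !fps_coef1; congr (_%:R).
rewrite -(inj_eq (inv_inj (@cmswapK i)) m); congr (nat_of_bool (_ == _)).
by apply: cm_ext => j; rewrite cmswapE !cm1.
Qed.

Lemma symmetric_fpsM f g :
  symmetric_fps f -> symmetric_fps g -> symmetric_fps (f * g).
Proof.
move=> fs gs i m; rewrite !fps_coefM.
rewrite (reindex_fsbig (fun p : M * M => (cmswap i p.1, cmswap i p.2))
  (factorizations m)); last first.
  split=> [[a b] /= <-|[a b] [c d] _ _ /= [/(inv_inj (@cmswapK i)) ->]|[a b] /= ab].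
  - by rewrite /factorizations /= cmswapM.
  - by move/(inv_inj (@cmswapK i)) => ->.
  exists (cmswap i a, cmswap i b); rewrite /= ?cmswapK //.
  by rewrite /factorizations /= -cmswapM ab cmswapK.
by apply: eq_fsbigr => p _ /=; rewrite fs gs.
Qed.

Lemma symmetric_fpsZ c f : symmetric_fps f -> symmetric_fps (c *: f).
Proof. by move=> fs i m; rewrite !fps_coefZ fs. Qed.

Lemma symmetric_fpsD f g :
  symmetric_fps f -> symmetric_fps g -> symmetric_fps (f + g).
Proof. by move=> fs gs i m; rewrite !fps_coefD fs gs. Qed.

Lemma homogeneous_fps1 : homogeneous_fps 0 1.
Proof.
move=> m; rewrite fps_coef1; have [->|] := eqVneq m mone; first by rewrite mdeg1.
by rewrite eqxx.
Qed.

Lemma homogeneous_fpsM d e f g : homogeneous_fps d f -> homogeneous_fps e g ->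
  homogeneous_fps (d + e) (f * g).
Proof.
move=> fd ge m /fps_coefM_neq0[m1 [m2 [-> /fd <- /ge <-]]].
exact: mdegM.
Qed.

Lemma homogeneous_fpsD d f g : homogeneous_fps d f -> homogeneous_fps d g ->
  homogeneous_fps d (f + g).
Proof.
move=> fd gd m; rewrite fps_coefD.
have [fm|/fd //] := eqVneq (fps_coef f m) 0.
by rewrite fm add0r => /gd.
Qed.

Lemma homogeneous_fpsZ d c f : homogeneous_fps d f -> homogeneous_fps d (c *: f).
Proof.
move=> fd m; rewrite fps_coefZ => cfm; apply: fd; apply: contra_neq cfm => ->.
by rewrite mulr0.
Qed.

End Series.

(** * Partitions as exponent vectors *)

Lemma geq_trans : transitive geq.
Proof. by move=> y x z /= yx zy; apply: leq_trans zy yx. Qed.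

Lemma part_gt0 (l : intpart) i : (i < size l)%N -> (0 < nth 0%N l i)%N.
Proof.
have /andP[_ l0] := partsP l.
by move=> il; rewrite lt0n; apply: contra l0 => /eqP <-; rewrite mem_nth.
Qed.

Lemma part_nonincr (l : intpart) i j : (i <= j)%N -> (nth 0 l j <= nth 0 l i)%N.
Proof.
have /andP[ls _] := partsP l.
move=> ij; have [jl|jl] := ltnP j (size l); last by rewrite nth_default.
have := @sorted_leq_nth _ geq geq_trans leqnn 0%N _ ls i j.
by rewrite !inE; apply=> //; apply: leq_ltn_trans ij jl.
Qed.

Lemma perm_eq_part (l1 l2 : intpart) : perm_eq l1 l2 -> l1 = l2.
Proof.
move=> l12; apply/val_inj/(sorted_eq geq_trans) => //.
- by move=> x y; rewrite andbC => /anti_leq.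
- by have /andP[] := partsP l1.
- by have /andP[] := partsP l2.
Qed.

Lemma size_le_sumn (l : intpart) : (size l <= sumn l)%N.
Proof.
rewrite sumnE (big_nth 0%N) big_mkord -[X in (X <= _)%N]card_ord -sum1_card.
by apply: leq_sum => i _; apply: part_gt0.
Qed.

(** This is y^lambda.  Among the monomials obtained from it by permuting the
    variables, it is the one with nonincreasing exponents. *)
Definition part_mon (l : intpart) : M :=
  \big[mmul/mone]_(j < size l) expcmn (ucm (j : nat)) (nth 0%N l j).

Lemma part_monE l i : part_mon l i = nth 0%N l i.
Proof.
rewrite cm_bigE; under eq_bigr do rewrite expcmnE ucmE.
have [il|il] := ltnP i (size l).
  rewrite (bigD1 (Ordinal il)) //= eqxx muln1 big1 ?addn0 // => j /negPf.
  by rewrite -val_eqE /= => ->; rewrite muln0.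
rewrite nth_default // big1 // => j _; case: eqVneq => [ji|_]; last exact: muln0.
by move: il; rewrite -ji leqNgt ltn_ord.
Qed.

Lemma part_mon_inj : injective part_mon.
Proof.
move=> l1 l2 l12; apply/val_inj => /=.
have l12E i : nth 0%N l1 i = nth 0%N l2 i by rewrite -!part_monE l12.
suff l12s : size l1 = size l2 by apply: (@eq_from_nth _ 0%N).
apply/eqP; rewrite eqn_leq; apply/andP; split; rewrite leqNgt; apply/negP => lt.
  by have := part_gt0 lt; rewrite l12E nth_default.
by have := part_gt0 lt; rewrite -l12E nth_default.
Qed.

Lemma finsupp_part_mon l : perm_eq (finsupp (part_mon l)) (iota 0 (size l)).
Proof.
apply: uniq_perm; rewrite ?fset_uniq ?iota_uniq // => i.
rewrite -cmE_neq0 part_monE mem_iota add0n /=.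
by have [/part_gt0|il] := ltnP i (size l); [rewrite lt0n|rewrite nth_default].
Qed.

Lemma mdeg_part_mon l : mdeg (part_mon l) = sumn l.
Proof.
rewrite mdegE (perm_big _ (finsupp_part_mon l)) /=.
under eq_bigr do rewrite part_monE.
by rewrite sumnE [RHS](big_nth 0%N) /index_iota subn0.
Qed.

(** On y^lambda this is the classical n(lambda) = sum_i (i - 1) lambda_i, and
    on the weight of a filling it is the sum of the entries. *)
Definition index_sum (m : M) : nat := (\sum_(k <- finsupp m) k * m k)%N.

Lemma index_sumEw (m : M) (d : {fset nat}) : (finsupp m `<=` d)%fset ->
  index_sum m = (\sum_(k <- d) k * m k)%N.
Proof.
move=> le; rewrite /index_sum (big_fset_incl _ le) //.
by move=> i i_in_d; rewrite -cmE_neq0 negbK => /eqP ->; rewrite muln0.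
Qed.

Lemma index_sum1 : index_sum mone = 0%N.
Proof. by rewrite /index_sum mdom1 big_seq_fset0. Qed.

Lemma index_sumM : {morph index_sum : m1 m2 / mmul m1 m2 >-> (m1 + m2)%N}.
Proof.
move=> m1 m2; rewrite /index_sum mdomD.
rewrite -/(index_sum m1) -/(index_sum m2) (index_sumEw (fsubsetUl _ (finsupp m2))).
rewrite (index_sumEw (fsubsetUr (finsupp m1) _)) -big_split /=.
by apply: eq_bigr => i _; rewrite cmM mulnDr.
Qed.

Lemma index_sum_ucm i : index_sum (ucm i) = i.
Proof. by rewrite /index_sum mdomU big_seq_fset1 cmUU muln1. Qed.

Lemma index_sum_big (T : Type) (r : seq T) (f : T -> M) :
  index_sum (\big[mmul/mone]_(x <- r) f x) = (\sum_(x <- r) index_sum (f x))%N.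
Proof. exact: (big_morph _ index_sumM index_sum1). Qed.

Lemma expcmn_ucmS (i n : nat) :
  expcmn (ucm i) n.+1 = mmul (ucm i) (expcmn (ucm i) n).
Proof. by apply: cm_ext => j; rewrite cmM !expcmnE mulSn. Qed.

Lemma index_sum_expcmn (i n : nat) : index_sum (expcmn (ucm i) n) = (n * i)%N.
Proof.
elim: n => [|n IH]; last by rewrite expcmn_ucmS index_sumM index_sum_ucm IH mulSn.
by rewrite -[RHS]index_sum1.
Qed.

(** Only the two exponents that are exchanged matter: the monomial is split
    into its part in these two variables and the rest [r]. *)
Lemma index_sum_cmswap i (m : M) : (m i < m i.+1)%N ->
  (index_sum (cmswap i m) < index_sum m)%N.
Proof.
pose r : M := mkcmonom [fsfun j in finsupp m =>
  (if nswap i j == j then m j else 0%N) | 0%N].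
have rE j : r j = if nswap i j == j then m j else 0%N.
  by rewrite /r cmE fsfun_fun; case: finsuppP => //; rewrite if_same.
have iS : (i.+1 == i) = false by rewrite gtn_eqF.
have mE : m = mmul (mmul (expcmn (ucm i) (m i)) (expcmn (ucm i.+1) (m i.+1))) r.
  apply: cm_ext => j; rewrite !cmM !expcmnE !ucmE rE.
  have [->|ji] := eqVneq j i; first by rewrite nswapl iS; lia.
  have [->|ji1] := eqVneq j i.+1; first by rewrite nswapr [i == _]eq_sym iS; lia.
  by rewrite nswap_id // eqxx; lia.
have smE : cmswap i m =
    mmul (mmul (expcmn (ucm i) (m i.+1)) (expcmn (ucm i.+1) (m i))) r.
  apply: cm_ext => j; rewrite cmswapE !cmM !expcmnE !ucmE rE.
  have [->|ji] := eqVneq j i; first by rewrite nswapl iS; lia.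
  have [->|ji1] := eqVneq j i.+1; first by rewrite nswapr [i == _]eq_sym iS; lia.
  by rewrite nswap_id // eqxx; lia.
move=> lt; rewrite smE [X in (_ < index_sum X)%N]mE !index_sumM !index_sum_expcmn.
by rewrite ltn_add2r; nia.
Qed.

Lemma nonincr_part_mon (m : M) : (forall i, m i.+1 <= m i)%N ->
  exists l, part_mon l = m.
Proof.
move=> mS; have [n0 mn0] : exists n, m n == 0%N.
  exists (\sum_(k <- finsupp m) k)%N.+1; rewrite cmE_eq0; apply/negP => inm.
  have : (\sum_(k <- finsupp m) k < \sum_(k <- finsupp m) k)%N.
    by rewrite [X in (_ < X)%N](big_fsetD1 _ inm) /= ltn_addr.
  by rewrite ltnn.
have mnon : {homo m : i j / (i <= j)%N >-> (j <= i)%N}.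
  by apply: homo_leq => // [x y z /[swap]]; apply: leq_trans.
have [n mn min_n] := ex_minnP (ex_intro (fun n => m n == 0%N) n0 mn0).
have lP : is_partition [seq m i | i <- iota 0 n].
  apply/andP; split.
    apply/(sortedP 0%N) => i; rewrite size_map size_iota => iltn.
    have ilen := ltnW iltn.
    by rewrite !(nth_map 0%N) ?size_iota // !nth_iota // /= !add0n mS.
  apply/mapP => -[k]; rewrite mem_iota => kn /esym/eqP /min_n; lia.
exists (IntPart lP); apply: cm_ext => i; rewrite part_monE /=.
have [iltn|nlei] := ltnP i n; first by rewrite (nth_map 0%N) ?size_iota ?nth_iota.
rewrite nth_default ?size_map ?size_iota //; apply/esym/eqP.
by move: (mnon _ _ nlei); rewrite (eqP mn) leqn0.
Qed.

(** Sorting the exponents by adjacent swaps terminates, because a swap that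
    puts a bigger exponent first decreases [index_sum]. *)
Lemma symmetric_fps_part_mon (F : comNzRingType) (f : fps F) m : symmetric_fps f ->
  exists l, fps_coef f m = fps_coef f (part_mon l).
Proof.
move=> fs; have [n] := ubnP (index_sum m); elim: n m => // n IH m.
rewrite ltnS => mn.
have [/nonincr_part_mon[l lm]|] := pselect (forall i, m i.+1 <= m i)%N.
  by exists l; rewrite lm.
move=> /existsNP[i /negP]; rewrite -ltnNge => /index_sum_cmswap lt.
by rewrite -(fs i m); apply: IH; apply: leq_trans lt mn.
Qed.

Lemma finite_intpart_deg d :
  exists s : seq intpart, forall l : intpart, sumn l = d -> l \in s.
Proof.
(* A partition of d is a list of d numbers at most d without its zeros. *)
pose g (t : {ffun 'I_d -> 'I_d.+1}) : option intpart :=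
  insub [seq x <- [seq val (t i) | i <- enum 'I_d] | x != 0%N].
exists (pmap g (enum {ffun 'I_d -> 'I_d.+1})) => l ld.
pose t : {ffun 'I_d -> 'I_d.+1} := [ffun i : 'I_d => inord (nth 0%N l i)].
rewrite mem_pmap; apply/mapP; exists t; rewrite ?mem_enum //.
have le_d i : (nth 0%N l i <= d)%N.
  have [il|il] := ltnP i (size l); last by rewrite nth_default.
  rewrite -ld sumnE (big_nth 0%N) big_mkord (bigD1 (Ordinal il)) //=.
  exact: leq_addr.
have size_l : (size l <= d)%N by rewrite -ld size_le_sumn.
have tE : [seq val (t i) | i <- enum 'I_d] = l ++ nseq (d - size l) 0%N.
  have -> : [seq val (t i) | i <- enum 'I_d] = [seq nth 0%N l i | i <- iota 0 d].
    rewrite -val_enum_ord -map_comp; apply: eq_map => i /=.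
    by rewrite ffunE inordK // ltnS le_d.
  apply: (@eq_from_nth _ 0%N).
    by rewrite size_map size_iota size_cat size_nseq subnKC.
  move=> i; rewrite size_map size_iota => id.
  rewrite (nth_map 0%N) ?size_iota ?nth_iota // add0n nth_cat nth_nseq.
  by case: ltnP => // il; rewrite nth_default ?if_same.
rewrite /g tE filter_cat filter_nseq /= cats0.
have -> : [seq x <- l | x != 0%N] = l.
  have /andP[_ l0] := partsP l.
  by apply/all_filterP/allP => x xl; apply: contra l0 => /eqP <-.
by have /= -> := valK l.
Qed.

(** * Triangular families of symmetric power series *)

(** The index set is arbitrary and [sh] identifies it with the partitions, so
    that the results apply both to Schur functions, indexed by partitions, and
    to products of power sums, indexed by monomials. *)
Section Triangular.
Variables (F : fieldType) (I : choiceType) (sh : I -> intpart) (b : I -> fps F).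
Variable rho : intpart -> nat.
Hypothesis sh_inj : injective sh.
Hypothesis sh_surj : forall l, exists i, sh i = l.
Hypothesis b_sym : forall i, symmetric_fps (b i).
Hypothesis b_hom : forall i, homogeneous_fps (sumn (sh i)) (b i).
Hypothesis b_diag : forall i, fps_coef (b i) (part_mon (sh i)) != 0.
Hypothesis b_tri : forall i l, fps_coef (b i) (part_mon l) != 0 ->
  l = sh i \/ (rho (sh i) < rho l)%N.

(** In a vanishing combination, pick an index [j] of minimal rank in the
    support: no other member of the support contributes to the coefficient at
    y^(sh j). *)
Lemma triangular_lift_inj : injective (malg_lift b).
Proof.
apply: raddf_inj => v bv0; apply/malgP => i; rewrite mcoeff0.
apply: contrapT => /eqP; rewrite mcoeff_neq0 => iv.
have exn : exists n, has (fun i => rho (sh i) == n) (msupp v).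
  by exists (rho (sh i)); apply/hasP; exists i.
have [n /hasP[j jv /eqP jn] min_n] := ex_minnP exn.
have := congr1 (fun f => fps_coef f (part_mon (sh j))) bv0.
rewrite /malg_lift fps_coef_sum (big_fsetD1 j) //= big1_fset.
  by move/eqP; rewrite addr0 mulf_eq0 (negPf (b_diag j)) mcoeff_eq0 jv.
move=> k; rewrite in_fsetD1 => /andP[kj kv] _.
have [->|/b_tri[/sh_inj jk|lt]] := eqVneq (fps_coef (b k) (part_mon (sh j))) 0.
- by rewrite mulr0.
- by rewrite jk eqxx in kj.
suff /min_n : has (fun i => rho (sh i) == rho (sh k)) (msupp v).
  by rewrite -jn leqNgt lt.
by apply/hasP; exists k.
Qed.

(** Gaussian elimination: the coefficients at the [part_mon l] are cleared in
    the order of increasing [rho l].  Subtracting a multiple of [b i] changes,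
    besides the coefficient that it clears, only coefficients of higher rank,
    so what has been cleared stays clear. *)
Lemma triangular_lift_surj d f : symmetric_fps f -> homogeneous_fps d f ->
  exists v, malg_lift b v = f.
Proof.
have [s0 s0P] := finite_intpart_deg d.
pose r := fun l1 l2 : intpart => (rho l1 <= rho l2)%N.
have r_tr : transitive r by move=> x y z; apply: leq_trans.
have r_tot : total r by move=> x y; apply: leq_total.
move=> f_sym f_hom.
(* The list s contains the partitions whose coefficient is not yet cleared;
   it is closed under passing to a partition of higher rank. *)
suff main (s : seq intpart) g : sorted r s ->
    (forall l1 l2 : intpart, l1 \in s -> sumn l2 = d -> (rho l1 < rho l2)%N ->
      l2 \in s) ->
    symmetric_fps g -> homogeneous_fps d g ->
    (forall l, fps_coef g (part_mon l) != 0 -> l \in s) ->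
    exists v, malg_lift b v = g.
  apply: (main (sort r s0)) => //; first exact: sort_sorted.
    by move=> l1 l2 _ l2d _; rewrite mem_sort s0P.
  by move=> l /f_hom ld; rewrite mem_sort s0P // -mdeg_part_mon.
elim: s g => [|l s IH] g /= s_sort s_up g_sym g_hom gs.
  exists 0; rewrite linear0; apply/esym/fpsP => m; apply/eqP/contraT.
  by have [l ->] := symmetric_fps_part_mon m g_sym => /gs.
have [i il] := sh_surj l.
have min_l k : k \in s -> (rho l <= rho k)%N.
  by move: s_sort; rewrite (path_sortedE r_tr) => /andP[/allP] ls _ /ls.
have [gl0|gl0] := eqVneq (fps_coef g (part_mon l)) 0.
  apply: IH => //; first exact: path_sorted s_sort.
    move=> l1 l2 l1s l2d lt; have := s_up l1 l2 _ l2d lt.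
    rewrite !inE l1s orbT => /(_ isT) /orP[/eqP l2l|//].
    by have := min_l _ l1s; rewrite -l2l leqNgt lt.
  move=> k gk; have := gs k gk; rewrite inE => /orP[/eqP kl|//].
  by rewrite kl gl0 eqxx in gk.
have ld : sumn l = d by rewrite -mdeg_part_mon (g_hom _ gl0).
pose c := fps_coef g (part_mon l) / fps_coef (b i) (part_mon l).
have bil : fps_coef (b i) (part_mon l) != 0 by rewrite -il b_diag.
have [|||||v vE] := IH (g + (- c) *: b i).
- exact: path_sorted s_sort.
- move=> l1 l2 l1s l2d lt; have := s_up l1 l2 _ l2d lt.
  rewrite !inE l1s orbT => /(_ isT) /orP[/eqP l2l|//].
  by have := min_l _ l1s; rewrite -l2l leqNgt lt.
- by apply: symmetric_fpsD => //; apply: symmetric_fpsZ.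
- apply: homogeneous_fpsD => //; apply: homogeneous_fpsZ.
  by rewrite -ld -il; apply: b_hom.
- move=> k; rewrite fps_coefD fps_coefZ.
  have [->|kl] := eqVneq k l; first by rewrite mulNr divfK // subrr eqxx.
  have [gk|/gs] := eqVneq (fps_coef g (part_mon k)) 0; last first.
    by rewrite inE (negPf kl).
  rewrite gk add0r mulf_eq0 negb_or => /andP[_ bk].
  have [ki|lt] := b_tri bk; first by rewrite ki il eqxx in kl.
  have kd : sumn k = d by rewrite -mdeg_part_mon (b_hom bk) il.
  have := s_up l k; rewrite !inE eqxx -il => /(_ isT kd lt).
  by rewrite il (negPf kl).
exists (v + c *: << i >>).
by rewrite linearD linearZ /= vE malg_lift1 scaleNr subrK.
Qed.

End Triangular.

(** * Boxes and row counts *)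

Lemma sum_ltn n k : (\sum_(c < n) (c < k) = minn n k)%N.
Proof.
by elim: n => [|n IH]; rewrite ?big_ord0 ?min0n // big_ord_recr /= IH; lia.
Qed.

(** A decreasing predicate on [0, n) holds on an initial segment, whose length
    is the number of points where it holds. *)
Lemma count_downward n (p : nat -> bool) c : (c < n)%N ->
  (forall c1 c2, (c1 <= c2 < n)%N -> p c2 -> p c1) ->
  p c = (c < \sum_(c' < n) p c')%N.
Proof.
move=> cn p_down; case: (boolP (p c)) => pc.
  apply/esym/(@leq_trans (\sum_(c' < n) (c' < c.+1))).
    by rewrite sum_ltn; lia.
  apply: leq_sum => c' _; case: ltnP => // c'c.
  by rewrite (p_down c' c) //; lia.
apply/esym/negbTE; rewrite -leqNgt.
apply: (@leq_trans (\sum_(c' < n) (c' < c))); last by rewrite sum_ltn; lia.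
apply: leq_sum => c' _; case: (boolP (p c')) => // pc'; rewrite lt0b.
rewrite ltnNge; apply: contra pc => cc'; apply: p_down pc'.
by rewrite cc' ltn_ord.
Qed.

Section Rows.
Variable l : intpart.
Implicit Types T : nat -> nat -> nat.

Definition row_mono T := forall i c1 c2,
  (c1 <= c2)%N -> (c2 < nth 0%N l i)%N -> (T i c1 <= T i c2)%N.

Definition col_strict T := forall i c,
  (c < nth 0%N l i.+1)%N -> (T i c < T i.+1 c)%N.

(** The shapes k |-> (row_count T k i)_i, formed by the boxes with entry less
    than k, are the levels of the Gelfand-Tsetlin pattern of the filling. *)
Definition row_count T k i : nat := (\sum_(c < nth 0%N l i) (T i c < k))%N.

Lemma row_count_le T k i : (row_count T k i <= nth 0%N l i)%N.
Proof.
rewrite -[X in (_ <= X)%N]card_ord -sum1_card.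
by apply: leq_sum => c _; apply: leq_b1.
Qed.

Lemma row_count_out T k i : (size l <= i)%N -> row_count T k i = 0%N.
Proof.
by move=> il; apply/eqP; rewrite -leqn0 -(nth_default 0%N il) row_count_le.
Qed.

Lemma row_count_mono T k1 k2 i :
  (k1 <= k2)%N -> (row_count T k1 i <= row_count T k2 i)%N.
Proof.
by move=> k12; apply: leq_sum => c _; case: ltnP => // /leq_trans ->.
Qed.

Lemma ltn_row_count T k i c : row_mono T -> (c < nth 0%N l i)%N ->
  (T i c < k)%N = (c < row_count T k i)%N.
Proof.
move=> Tm cl; apply: (@count_downward _ (fun c => T i c < k)%N) => // c1 c2.
by move=> /andP[c12 c2l]; apply: leq_ltn_trans (Tm _ _ _ c12 c2l).
Qed.

Lemma eq_row_count T1 T2 k i :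
  (forall c, (c < nth 0%N l i)%N -> (T1 i c < k)%N = (T2 i c < k)%N) ->
  row_count T1 k i = row_count T2 k i.
Proof. by move=> T12; apply: eq_bigr => c _; rewrite T12. Qed.

Lemma row_countS T k i : row_count T k.+1 i =
  (row_count T k i + \sum_(c < nth 0%N l i) (T i c == k))%N.
Proof. by rewrite -big_split; apply: eq_bigr => c _ /=; lia. Qed.

(** Column strictness says that consecutive levels of the Gelfand-Tsetlin
    pattern interlace: the boxes with entry k form a horizontal strip. *)
Lemma col_strict_countP T : row_mono T ->
  col_strict T <-> forall k i, (row_count T k.+1 i.+1 <= row_count T k i)%N.
Proof.
move=> Tm; split=> [Tc k i|TN i c cl].
  rewrite leqNgt; apply/negP => lt; set c := row_count T k i in lt.
  have cl : (c < nth 0%N l i.+1)%N by apply: leq_trans lt (row_count_le _ _ _).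
  have cl' : (c < nth 0%N l i)%N by apply: leq_trans cl (part_nonincr _ _).
  have := Tc i c cl; move: lt; rewrite -ltn_row_count // ltnS => le1 /leq_trans.
  by move=> /(_ _ le1); rewrite (ltn_row_count _ Tm) // ltnn.
have cl' : (c < nth 0%N l i)%N by apply: leq_trans cl (part_nonincr _ _).
rewrite (ltn_row_count _ Tm) //; apply: leq_trans (TN _ _).
by rewrite -ltn_row_count.
Qed.

(** The entries equal to [s] and [s.+1] are determined by the level [s.+1] of
    the Gelfand-Tsetlin pattern.  When the other levels are fixed, the i-th
    number of this level ranges over an interval, from [bk_lo i] to [bk_hi i],
    and these conditions for distinct i are independent.  The Bender-Knuth
    involution reflects each number in the midpoint of its interval. *)
Section BenderKnuth.
Variables (s : nat) (T : nat -> nat -> nat).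
Hypotheses (Tm : row_mono T) (Tc : col_strict T).

Definition bk_hi i :=
  if i is j.+1 then minn (row_count T s.+2 i) (row_count T s j)
  else row_count T s.+2 0.

Definition bk_lo i := maxn (row_count T s.+2 i.+1) (row_count T s i).

Definition bk_count i := (bk_lo i + bk_hi i - row_count T s.+1 i)%N.

Definition bender_knuth i c :=
  if (s <= T i c <= s.+1)%N then (if (c < bk_count i)%N then s else s.+1)
  else T i c.

Lemma bk_bounds i : (bk_lo i <= row_count T s.+1 i <= bk_hi i)%N.
Proof.
have /(col_strict_countP Tm) TN := Tc.
have le_s := row_count_mono T i (leqnSn s).
have le_s1 := row_count_mono T i (leqnSn s.+1).
apply/andP; split; first by rewrite geq_max TN.
by case: i le_s le_s1 => [|i] le_s le_s1 //=; rewrite leq_min le_s1 TN.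
Qed.

Lemma bk_count_bounds i : (bk_lo i <= bk_count i <= bk_hi i)%N.
Proof. by have := bk_bounds i; rewrite /bk_count; lia. Qed.

Lemma bk_hi_le i : (bk_hi i <= row_count T s.+2 i)%N.
Proof. by case: i => //= i; apply: geq_minl. Qed.

Lemma bk_lo_ge i : (row_count T s i <= bk_lo i)%N.
Proof. exact: leq_maxr. Qed.

Lemma bk_row_mono : row_mono bender_knuth.
Proof.
move=> i c1 c2 c12 c2l; have := Tm c12 c2l; rewrite /bender_knuth.
by do 2![case: ifP => ?]; do ?[case: ifP => ?]; lia.
Qed.

Lemma bk_row_count_id k i : k != s.+1 ->
  row_count bender_knuth k i = row_count T k i.
Proof.
move=> ks; apply: eq_row_count => c _; rewrite /bender_knuth.
by do ?[case: ifP => ?]; lia.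
Qed.

Lemma bk_row_countE i : row_count bender_knuth s.+1 i = bk_count i.
Proof.
have := bk_count_bounds i; have := bk_hi_le i; have := bk_lo_ge i.
have := row_count_le T s.+2 i => al blo hia /andP[loc chi].
transitivity (\sum_(c < nth 0%N l i) (c < bk_count i))%N.
  2: by rewrite sum_ltn; lia.
apply: eq_bigr => c _; congr nat_of_bool.
have := ltn_row_count s Tm (ltn_ord c).
have := ltn_row_count s.+2 Tm (ltn_ord c).
rewrite /bender_knuth; case: (ltnP c (bk_count i)) => ?; case: ifP => ?; lia.
Qed.

Lemma bk_col_strict : col_strict bender_knuth.
Proof.
apply/(col_strict_countP bk_row_mono) => k i.
have /(col_strict_countP Tm) TN := Tc.
have [->|ks] := eqVneq k s.
  rewrite bk_row_countE bk_row_count_id; last by lia.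
  have /andP[_ /leq_trans] := bk_count_bounds i.+1; apply; exact: geq_minr.
have [->|ks1] := eqVneq k s.+1.
  rewrite bk_row_countE bk_row_count_id; last by lia.
  have /andP[+ _] := bk_count_bounds i; apply: leq_trans; exact: leq_maxl.
by rewrite !bk_row_count_id //; lia.
Qed.

(** The identity max + min = sum telescopes: the lower bound in row i and the
    upper bound in row i + 1 are the maximum and the minimum of the same two
    numbers.  The last terms on both sides account for the shift of rows. *)
Lemma bk_sum n :
  (\sum_(i < n) (bk_lo i + bk_hi i) + bk_hi n =
   \sum_(i < n) (row_count T s.+2 i + row_count T s i) + row_count T s.+2 n)%N.
Proof.
elim: n => [|n IH]; first by rewrite !big_ord0.
by move: IH; rewrite !big_ord_recr /= /bk_lo; lia.
Qed.

(** Hence the reflection exchanges the number of entries [s] and the number of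
    entries [s.+1]. *)
Lemma bk_count_sum : (\sum_(i < size l) bk_count i +
    \sum_(i < size l) row_count T s.+1 i =
  \sum_(i < size l) row_count T s.+2 i + \sum_(i < size l) row_count T s i)%N.
Proof.
have := bk_sum (size l); rewrite [X in _ = (_ + X)%N]row_count_out // addn0.
have -> : bk_hi (size l) = 0%N.
  by apply/eqP; rewrite -leqn0 (leq_trans (bk_hi_le _)) // row_count_out.
rewrite addn0 -!big_split /= => <-; apply: eq_bigr => i _.
by have := bk_bounds i; rewrite /bk_count; lia.
Qed.

End BenderKnuth.

Definition value_count T k :=
  (\sum_(i < size l) \sum_(c < nth 0%N l i) (T i c == k))%N.

Lemma value_countE T k : (value_count T k + \sum_(i < size l) row_count T k i =
  \sum_(i < size l) row_count T k.+1 i)%N.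
Proof.
rewrite addnC /value_count -big_split; apply: eq_bigr => i _ /=.
by rewrite row_countS.
Qed.

Lemma value_count_bk s T k : row_mono T -> col_strict T ->
  value_count (bender_knuth s T) k = value_count T (nswap s k).
Proof.
move=> Tm Tc.
have bkE : (\sum_(i < size l) row_count (bender_knuth s T) s.+1 i =
    \sum_(i < size l) bk_count s T i)%N.
  by apply: eq_bigr => i _; apply: bk_row_countE.
have bk_id j : j != s.+1 -> (\sum_(i < size l) row_count (bender_knuth s T) j i =
    \sum_(i < size l) row_count T j i)%N.
  by move=> js; apply: eq_bigr => i _; apply: bk_row_count_id.
have sumE := bk_count_sum s Tm Tc.
have [->|ks] := eqVneq k s.
  have := value_countE (bender_knuth s T) s; have := value_countE T s.+1.
  by rewrite nswapl bkE bk_id; lia.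
have [->|ks1] := eqVneq k s.+1.
  have := value_countE (bender_knuth s T) s.+1; have := value_countE T s.
  by rewrite nswapr bkE bk_id; lia.
rewrite nswap_id //; apply: eq_bigr => i _; apply: eq_bigr => c _.
congr nat_of_bool; rewrite /bender_knuth.
by do ?[case: ifP => ?]; lia.
Qed.


(** [T2] stands for the transformed filling, which agrees with the transform
    of [T1] on the diagram but not necessarily outside it. *)
Lemma bender_knuthK s T1 T2 : row_mono T1 -> col_strict T1 ->
  (forall i c, (c < nth 0%N l i)%N -> T2 i c = bender_knuth s T1 i c) ->
  forall i c, (c < nth 0%N l i)%N -> bender_knuth s T2 i c = T1 i c.
Proof.
move=> Tm Tc T12 i c cl.
have rc_id k j : k != s.+1 -> row_count T2 k j = row_count T1 k j.
  move=> ks; rewrite -(bk_row_count_id T1 _ ks).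
  by apply: eq_row_count => c' /T12 ->.
have rcE j : row_count T2 s.+1 j = bk_count s T1 j.
  by rewrite -bk_row_countE //; apply: eq_row_count => c' /T12 ->.
have loE j : bk_lo s T2 j = bk_lo s T1 j by rewrite /bk_lo !rc_id //; lia.
have hiE j : bk_hi s T2 j = bk_hi s T1 j.
  by case: j => [|j] /=; rewrite !rc_id //; lia.
have countE : bk_count s T2 i = row_count T1 s.+1 i.
  rewrite /bk_count loE hiE rcE.
  by have := bk_bounds s Tm Tc i; rewrite /bk_count; lia.
have := ltn_row_count s.+1 Tm cl.
rewrite /bender_knuth countE T12 // /bender_knuth.
have [T1s|/negPf T1s] := boolP (s <= T1 i c <= s.+1)%N; last by rewrite T1s.
by case: (c < bk_count s T1 i)%N; rewrite ?leqnn ?leqnSn /=; case: ifP; lia.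
Qed.

End Rows.

(** * Fillings *)

Section Fillings.
Variable l : intpart.
Implicit Types (t : filling l) (b : box l).

Lemma box_col_lt b : (box_col b < nth 0%N l (box_row b))%N.
Proof. exact: ltn_ord. Qed.

Lemma box_inj b1 b2 :
  box_row b1 = box_row b2 -> box_col b1 = box_col b2 -> b1 = b2.
Proof.
case: b1 b2 => [i c] [j d]; rewrite /box_row /box_col /= => /val_inj ij.
by case: j / ij d => d /val_inj ->.
Qed.

Lemma box_exists i c : (c < nth 0%N l i)%N ->
  exists b, box_row b = i /\ box_col b = c.
Proof.
move=> ci; have [il|il] := ltnP i (size l); last by rewrite nth_default in ci.
by exists (Tagged (fun i : 'I_(size l) => 'I_(nth 0%N l i))
  (Ordinal (ci : (c < nth 0%N l (Ordinal il))%N))).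
Qed.

Lemma sum_box (f : nat -> nat -> nat) :
  (\sum_(b : box l) f (box_row b) (box_col b) =
  \sum_(i < size l) \sum_(c < nth 0%N l i) f i c)%N.
Proof.
by rewrite (@sig_big_dep _ _ _ 'I_(size l) (fun i : 'I_(size l) => 'I_(nth 0%N l i))
  xpredT (fun=> xpredT) (fun (i : 'I_(size l)) (c : 'I_(nth 0%N l i)) => f i c)).
Qed.

(** The total function behind a filling, with value 0 outside the diagram. *)
Definition fget t i c : nat :=
  if [pick b | (box_row b == i) && (box_col b == c)] is Some b then t b else 0%N.

Lemma fgetE t b : fget t (box_row b) (box_col b) = t b.
Proof.
rewrite /fget; case: pickP => [b' /andP[/eqP r /eqP c]|/(_ b)].
  by rewrite (box_inj r c).
by rewrite !eqxx.
Qed.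

Lemma column_strictP t :
  column_strict t <-> row_mono l (fget t) /\ col_strict l (fget t).
Proof.
split=> [[trow tcol]|[trow tcol]].
  split=> [i c1 c2 c12 c2l|i c cl].
    have [b1 [b1i b1c]] := box_exists (leq_ltn_trans c12 c2l).
    have [b2 [b2i b2c]] := box_exists c2l.
    rewrite -{1}b1i -b1c -{1}b2i -b2c !fgetE; apply: trow; first by rewrite b1i.
    by rewrite b1c b2c.
  have [b1 [b1i b1c]] := box_exists cl.
  have [b2 [b2i b2c]] := box_exists (leq_trans cl (part_nonincr l (leqnSn i))).
  rewrite -b1i -{2}b1c -b2i -b2c !fgetE; apply: tcol; first by rewrite b1c.
  by rewrite b1i b2i.
split=> b1 b2.
  move=> rE c12; rewrite -!fgetE rE; apply: trow => //; exact: box_col_lt.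
move=> cE; rewrite -!fgetE cE; have := box_col_lt b2.
elim: (box_row b2) => // i IH cl; rewrite ltnS leq_eqVlt => /orP[/eqP ->|lt].
  exact: tcol.
apply: ltn_trans (tcol _ _ cl); apply: IH => //.
exact: leq_trans cl (part_nonincr l (leqnSn i)).
Qed.

Lemma filling_weightE t k : filling_weight t k = value_count l (fget t) k.
Proof.
rewrite /filling_weight cm_bigE /value_count.
rewrite -(sum_box (fun i c => fget t i c == k)).
by apply: eq_bigr => b _; rewrite ucmE fgetE.
Qed.

Definition bk_filling s t : filling l :=
  [ffun b => bender_knuth l s (fget t) (box_row b) (box_col b)].

Lemma fget_bk s t i c : (c < nth 0%N l i)%N ->
  fget (bk_filling s t) i c = bender_knuth l s (fget t) i c.
Proof. by move=> /box_exists[b [<- <-]]; rewrite fgetE ffunE. Qed.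

Lemma bk_column_strict s t : column_strict t -> column_strict (bk_filling s t).
Proof.
move=> /column_strictP[tm tc]; apply/column_strictP; split.
  move=> i c1 c2 c12 c2l; rewrite !fget_bk //; first exact: bk_row_mono.
  exact: leq_ltn_trans c12 c2l.
move=> i c cl; rewrite !fget_bk //; first exact: bk_col_strict.
exact: leq_trans cl (part_nonincr l (leqnSn i)).
Qed.

Lemma bk_filling_weight s t : column_strict t ->
  filling_weight (bk_filling s t) = cmswap s (filling_weight t).
Proof.
move=> /column_strictP[tm tc]; apply: cm_ext => k.
rewrite cmswapE !filling_weightE -value_count_bk //.
by apply: eq_bigr => i _; apply: eq_bigr => c _; rewrite fget_bk.
Qed.

Lemma bk_fillingK s t : column_strict t -> bk_filling s (bk_filling s t) = t.
Proof.
move=> /column_strictP[tm tc]; apply/ffunP => b; rewrite ffunE -[RHS]fgetE.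
apply: bender_knuthK => //; last exact: box_col_lt.
by move=> i c; apply: fget_bk.
Qed.

Definition row_filling : filling l := [ffun b => box_row b].

Lemma row_filling_strict : column_strict row_filling.
Proof. by split=> b1 b2; rewrite !ffunE => // ->. Qed.

Lemma row_filling_weight : filling_weight row_filling = part_mon l.
Proof.
apply: cm_ext => k; rewrite cm_bigE part_monE.
under eq_bigr do rewrite ucmE ffunE.
rewrite (sum_box (fun i c => i == k)).
under eq_bigr do rewrite sum_nat_const card_ord.
have [kl|kl] := ltnP k (size l).
  rewrite (bigD1 (Ordinal kl)) //= eqxx muln1 big1 ?addn0 // => j /negPf.
  by rewrite -val_eqE /= => ->; rewrite muln0.
rewrite nth_default // big1 // => j _; case: eqVneq => [ji|_]; last exact: muln0.
by move: kl; rewrite -ji leqNgt ltn_ord.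
Qed.

Lemma column_strict_ge_row t b : column_strict t -> (box_row b <= t b)%N.
Proof.
move=> /column_strictP[_ tc]; rewrite -fgetE; have := box_col_lt b.
elim: (box_row b) => // i IH cl; apply: leq_ltn_trans (tc _ _ cl).
by apply: IH; apply: leq_trans cl (part_nonincr l (leqnSn i)).
Qed.

Lemma index_sum_weight t : index_sum (filling_weight t) = (\sum_(b : box l) t b)%N.
Proof. by rewrite index_sum_big; apply: eq_bigr => b _; rewrite index_sum_ucm. Qed.

Lemma mdeg_weight t : mdeg (filling_weight t) = sumn l.
Proof.
rewrite /filling_weight mdeg_prod; under eq_bigr do rewrite mdegU.
rewrite (sum_box (fun _ _ => 1%N)) sumnE (big_nth 0%N) big_mkord.
by apply: eq_bigr => i _; rewrite sum1_card card_ord.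
Qed.

(** In a column-strict filling an entry is at least the index of its row, so
    the sum of the entries, which depends on the weight alone, is at least its
    value on the filling of each row by its own index. *)
Lemma column_strict_index_sum t : column_strict t ->
  t = row_filling \/ (index_sum (part_mon l) < index_sum (filling_weight t))%N.
Proof.
move=> ts; have [->|/eqP tr] := eqVneq t row_filling; [by left|right].
rewrite -row_filling_weight !index_sum_weight.
have [b tb] : exists b, t b != row_filling b.
  apply: contrapT => /forallNP tE; apply: tr; apply/ffunP => b.
  by apply/eqP/negP => /negP/tE.
rewrite (bigD1 b) //= [X in (_ < X)%N](bigD1 b) //= -addSn leq_add //.
  by rewrite ltn_neqAle eq_sym tb ffunE column_strict_ge_row.
by apply: leq_sum => b' _; rewrite ffunE column_strict_ge_row.
Qed.

End Fillings.

(** * Schur functions *)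

Section Schur.
Variables (F : comNzRingType) (l : intpart).

Lemma schur_coefE m : fps_coef (schur F l) m =
  \sum_(t \in [set t | column_strict t] `&` @filling_weight l @^-1` [set m])
    (1 : F).
Proof. by []. Qed.

Lemma schur_coef_neq0 m : fps_coef (schur F l) m != 0 ->
  exists2 t : filling l, column_strict t & filling_weight t = m.
Proof.
move=> sm; apply: contrapT => no; move/eqP: sm; apply.
rewrite schur_coefE; apply: fsbig1 => t [/= ts tm].
by case: no; exists t.
Qed.

(** The Bender-Knuth involution is a bijection between the fillings of the two
    weights that are exchanged. *)
Lemma schur_sym : symmetric_fps (schur F l).
Proof.
move=> s m; rewrite !schur_coefE.
rewrite (reindex_fsbig (@bk_filling l s)
  ([set t | column_strict t] `&` @filling_weight l @^-1` [set m])) //.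
split=> [t [/= ts tm]|t1 t2 /set_mem[/= ts1 _] /set_mem[/= ts2 _] t12|t [/= ts tm]].
- by split=> /=; [apply: bk_column_strict|rewrite bk_filling_weight // tm].
- by rewrite -(bk_fillingK s ts1) t12 bk_fillingK.
- exists (bk_filling s t); last exact: bk_fillingK.
  split=> /=; first exact: bk_column_strict.
  by rewrite bk_filling_weight // tm cmswapK.
Qed.

Lemma schur_hom : homogeneous_fps (sumn l) (schur F l).
Proof. by move=> m /schur_coef_neq0[t _ <-]; apply: mdeg_weight. Qed.

Lemma schur_tri l' : fps_coef (schur F l) (part_mon l') != 0 ->
  l' = l \/ (index_sum (part_mon l) < index_sum (part_mon l'))%N.
Proof.
move=> /schur_coef_neq0[t /column_strict_index_sum[->|lt] tl'].
  by left; apply: part_mon_inj; rewrite -tl' row_filling_weight.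
by right; rewrite -tl'.
Qed.

Lemma schur_diag : fps_coef (schur F l) (part_mon l) = 1.
Proof.
rewrite schur_coefE -[RHS](@fsbig_set1 F 0 +%R _ (row_filling l) (fun=> 1)).
apply: eq_fsbigl; apply/seteqP; split=> [t [/= ts tl]|t ->] /=.
  by have [->//|] := column_strict_index_sum ts; rewrite tl ltnn.
by split=> /=; [apply: row_filling_strict|apply: row_filling_weight].
Qed.

End Schur.

(** * Monomials in the power sums *)

(** The monomials of C[x_1, x_2, ...] correspond to partitions by
    multiplicities: the exponent of x_k is the number of parts equal to k. *)
Definition mult_mon (l : intpart) : M := \big[mmul/mone]_(k <- l) ucm k.-1.

Lemma mult_monE l i : mult_mon l i = count_mem i.+1 l.
Proof.
rewrite cm_bigE -sum1_count [RHS]big_mkcond /= [LHS]big_seq [RHS]big_seq.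
apply: eq_bigr => k kl.
rewrite ucmE; have /andP[_ l0] := partsP l.
by case: k kl => [kl|k _] /=; [rewrite kl in l0|rewrite eqSS; case: eqP].
Qed.

Fact shape_subproof (m : M) :
  is_partition (sort geq (flatten [seq nseq (m i) i.+1 | i <- finsupp m])).
Proof.
apply/andP; split; first by apply: sort_sorted => x y; apply: leq_total.
rewrite mem_sort; apply/negP => /flattenP[/= s /mapP[i _ ->]].
by rewrite mem_nseq andbC.
Qed.

Definition shape_mon (m : M) : intpart := IntPart (shape_subproof m).

Lemma shape_monK : cancel shape_mon mult_mon.
Proof.
move=> m; apply: cm_ext => i; rewrite mult_monE /= count_sort count_flatten.
rewrite sumnE !big_map; under eq_bigr do rewrite count_nseq /= eqSS.
have [im|im] := boolP (i \in finsupp m).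
  rewrite (big_fsetD1 i) //= eqxx mul1n big1_fset ?addn0 // => j.
  by rewrite in_fsetD1 => /andP[/negPf -> _].
rewrite big1_seq => [|j /= jm]; first by move: im; rewrite -cmE_eq0 => /eqP.
by case: eqVneq => // ji; rewrite -ji jm in im.
Qed.

Lemma mult_monK : cancel mult_mon shape_mon.
Proof.
move=> l; apply/perm_eq_part/allP => -[|i] _; apply/eqP.
  have /andP[_ /count_memPn ->] := partsP l.
  by have /andP[_ /count_memPn ->] := partsP (shape_mon (mult_mon l)).
by have := mult_monE (shape_mon (mult_mon l)) i; rewrite shape_monK mult_monE => ->.
Qed.

Section Substitution.
Variables (F : comNzRingType) (S : comAlgType F) (u : nat -> S).

Definition mon_eval (m : M) : S := \prod_(i <- finsupp m) u i ^+ m i.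

Lemma subst_poly_lift (P : xpoly F) : subst_poly u P = malg_lift mon_eval P.
Proof. by apply: eq_bigr => m _; rewrite mulr_algl. Qed.

Lemma mon_evalEw (m : M) (d : {fset nat}) : (finsupp m `<=` d)%fset ->
  mon_eval m = \prod_(i <- d) u i ^+ m i.
Proof.
move=> le; rewrite /mon_eval (big_fset_incl _ le) //.
by move=> i _; rewrite -cmE_neq0 negbK => /eqP ->; rewrite expr0.
Qed.

Lemma mon_eval1 : mon_eval mone = 1.
Proof. by rewrite /mon_eval mdom1 big_seq_fset0. Qed.

Lemma mon_evalM : {morph mon_eval : m1 m2 / mmul m1 m2 >-> m1 * m2}.
Proof.
move=> m1 m2; rewrite /mon_eval mdomD.
rewrite -/(mon_eval m1) -/(mon_eval m2) (mon_evalEw (fsubsetUl _ (finsupp m2))).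
rewrite (mon_evalEw (fsubsetUr (finsupp m1) _)) -big_split /=.
by apply: eq_bigr => i _; rewrite cmM exprD.
Qed.

Lemma mon_evalU i : mon_eval (ucm i) = u i.
Proof. by rewrite /mon_eval mdomU big_seq_fset1 cmUU expr1. Qed.

Lemma mon_eval_shape m : mon_eval m = \prod_(k <- shape_mon m) u k.-1.
Proof.
rewrite -[in LHS](shape_monK m) /mult_mon (big_morph _ mon_evalM mon_eval1).
by apply: eq_bigr => k _; rewrite mon_evalU.
Qed.

End Substitution.

Section PowerSum.
Variable F : comNzRingType.

Lemma mdeg_expcmn (i n : nat) : mdeg (expcmn (ucm i) n) = n.
Proof.
elim: n => [|n IH]; last by rewrite expcmn_ucmS mdegM mdegU IH.
by rewrite -[RHS](@mdeg1 nat).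
Qed.

Lemma power_sum_coefE k m : fps_coef (power_sum F k) m =
  \sum_(i \in [set: nat] `&` (fun i => expcmn (ucm i) k) @^-1` [set m]) (1 : F).
Proof. by []. Qed.

Lemma power_sum_coef_neq0 k m : fps_coef (power_sum F k) m != 0 ->
  exists i, m = expcmn (ucm i) k.
Proof.
move=> pm; apply: contrapT => no; move/eqP: pm; apply.
rewrite power_sum_coefE; apply: fsbig1 => i [_ /= im].
by case: no; exists i.
Qed.

Lemma power_sum_coef1 k i : (0 < k)%N ->
  fps_coef (power_sum F k) (expcmn (ucm i) k) = 1.
Proof.
move=> k0; rewrite power_sum_coefE -[RHS](@fsbig_set1 F 0 +%R _ i (fun=> 1)).
apply: eq_fsbigl; apply/seteqP; split=> [j [_ /= ji]|j ->] //=.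
have := congr1 (fun m : M => m j) ji; rewrite !expcmnE !ucmE eqxx.
by case: (eqVneq i j) => //= _; rewrite muln0 muln1; case: k k0 {ji}.
Qed.

Lemma power_sum_sym k : symmetric_fps (power_sum F k).
Proof.
move=> s m; rewrite !power_sum_coefE.
have swapE i : expcmn (ucm (nswap s i)) k = cmswap s (expcmn (ucm i) k).
  apply: cm_ext => j; rewrite cmswapE !expcmnE !ucmE.
  by rewrite -(inj_eq (inv_inj (@nswapK s))) nswapK.
rewrite (reindex_fsbig (nswap s)
  ([set: nat] `&` (fun i => expcmn (ucm i) k) @^-1` [set m])) //.
split=> [i [_ /= im]|i j _ _|i [_ /= im]].
- by split=> //=; rewrite swapE im.
- exact: (inv_inj (@nswapK s)).
- by exists (nswap s i); rewrite ?nswapK //; split=> //=; rewrite swapE im cmswapK.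
Qed.

Lemma power_sum_hom k : homogeneous_fps k (power_sum F k).
Proof. by move=> m /power_sum_coef_neq0[i ->]; apply: mdeg_expcmn. Qed.

End PowerSum.

Section PowerSumNum.
Variable F : numFieldType.

(** Nonnegative coefficients cannot cancel, so a single positive contribution
    to a coefficient makes it nonzero. *)
Definition fps_ge0 (f : fps F) := forall m, 0 <= fps_coef f m.

Lemma fps_ge0M f g : fps_ge0 f -> fps_ge0 g -> fps_ge0 (f * g).
Proof. by move=> f0 g0 m; apply: fsumr_ge0 => p _; apply: mulr_ge0. Qed.

Lemma fps_coefM_gt0 f g m1 m2 : fps_ge0 f -> fps_ge0 g ->
  0 < fps_coef f m1 -> 0 < fps_coef g m2 -> 0 < fps_coef (f * g) (mmul m1 m2).
Proof.
move=> f0 g0 fm gm; set m := mmul m1 m2.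
change (0 < fps_coef (fps_mul f g) m).
rewrite (@fps_mulE _ m (cm_divisors m)) //.
have m1D : m1 \in cm_divisors m by apply/cm_divisorsP; exists m2.
have m2D : m2 \in cm_divisors m by apply/cm_divisorsP; exists m1; rewrite mulmC.
have ge0 a b : 0 <= (fps_coef f a * fps_coef g b) *+ (mmul a b == m).
  by rewrite mulrn_wge0 // mulr_ge0.
rewrite (big_fsetD1 _ m1D) (big_fsetD1 _ m2D) /= eqxx mulr1n.
apply: ltr_wpDr; first by apply: sumr_ge0 => a _; apply: sumr_ge0.
by apply: ltr_wpDr; [apply: sumr_ge0|apply: mulr_gt0].
Qed.

Definition scaled_power_sum i : fps F := i.+1%:R^-1 *: power_sum F i.+1.

Lemma scaled_power_sum_coef_neq0 i m : fps_coef (scaled_power_sum i) m != 0 ->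
  exists j, m = expcmn (ucm j) i.+1.
Proof.
by rewrite fps_coefZ mulf_eq0 negb_or => /andP[_ /power_sum_coef_neq0].
Qed.

Lemma scaled_power_sum_ge0 i : fps_ge0 (scaled_power_sum i).
Proof.
move=> m; rewrite fps_coefZ mulr_ge0 ?invr_ge0 ?ler0n //.
by apply: fsumr_ge0 => _ _; apply: ler01.
Qed.

Lemma scaled_power_sum_gt0 i j :
  0 < fps_coef (scaled_power_sum i) (expcmn (ucm j) i.+1).
Proof. by rewrite fps_coefZ power_sum_coef1 // mulr1 invr_gt0 ltr0n. Qed.

Local Notation power_mon := (mon_eval scaled_power_sum).

Lemma power_mon_sym m : symmetric_fps (power_mon m).
Proof.
rewrite /mon_eval; apply: (big_ind (@symmetric_fps F)).
- exact: symmetric_fps1.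
- by move=> f g; apply: symmetric_fpsM.
move=> i _; elim: (m i) => [|n IH]; first exact: symmetric_fps1.
rewrite exprS; apply: symmetric_fpsM => //.
by apply: symmetric_fpsZ; apply: power_sum_sym.
Qed.

Lemma power_mon_hom m : homogeneous_fps (sumn (shape_mon m)) (power_mon m).
Proof.
rewrite mon_eval_shape; have /andP[_] := partsP (shape_mon m).
elim: (parts _) => [|k s IH].
  by rewrite big_nil => _; apply: homogeneous_fps1.
rewrite inE negb_or => /andP[k0 /IH s_hom]; rewrite big_cons /=.
apply: homogeneous_fpsM => //; apply: homogeneous_fpsZ.
by case: k k0 => // k _; apply: power_sum_hom.
Qed.

(** Choosing y_j in the factor of the j-th part contributes y^lambda. *)
Lemma power_mon_diag m : fps_coef (power_mon m) (part_mon (shape_mon m)) != 0.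
Proof.
rewrite mon_eval_shape; move: (shape_mon m) => l; rewrite (big_nth 0%N) big_mkord.
suff [_ /lt0r_neq0] : fps_ge0 (\prod_(j < size l) scaled_power_sum (nth 0%N l j).-1)
  /\ 0 < fps_coef (\prod_(j < size l) scaled_power_sum (nth 0%N l j).-1)
           (part_mon l) by [].
rewrite /part_mon; apply: (big_ind2 (fun m f => fps_ge0 f /\ 0 < fps_coef f m)).
- split; last by rewrite fps_coef1 eqxx ltr01.
  by move=> m'; rewrite fps_coef1 ler0n.
- move=> m1 f1 m2 f2 [f10 f1m] [f20 f2m]; split; first exact: fps_ge0M.
  exact: fps_coefM_gt0.
- move=> j _; split; first exact: scaled_power_sum_ge0.
  by have := part_gt0 (ltn_ord j); case: (nth 0%N l j) => // k _;
    apply: scaled_power_sum_gt0.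
Qed.

(** A monomial of a product of power sums collects one pure power from each
    factor; it involves as many variables as there are factors only when no
    two of these powers meet. *)
Lemma prod_power_sum_neq0 (s : seq nat) (m : M) : 0%N \notin s ->
  fps_coef (\prod_(k <- s) scaled_power_sum k.-1) m != 0 ->
  (size (finsupp m) < size s)%N \/ perm_eq s [seq m i | i <- finsupp m].
Proof.
elim: s m => [|k s IH] m.
  rewrite big_nil fps_coef1 => _; have [-> _|_] := eqVneq m mone.
    by right; rewrite mdom1.
  by rewrite eqxx.
rewrite inE negb_or big_cons => /andP[k0 s0] /fps_coefM_neq0[m1 [m' [-> + sm']]].
case: k k0 => // k _ /scaled_power_sum_coef_neq0[i ->].
have := IH _ s0 sm'; move: m' {sm'} => m'.
have dom1 : finsupp (expcmn (ucm i) k.+1) = [fset i]%fset.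
  apply/fsetP => j; rewrite -cmE_neq0 expcmnE ucmE in_fset1.
  by rewrite [RHS]eq_sym; case: (eqVneq i j) => _; rewrite ?muln0 ?muln1.
have domE : finsupp (mmul (expcmn (ucm i) k.+1) m') = (i |` finsupp m')%fset.
  by rewrite mdomD dom1.
have [im'|im'] := boolP (i \in finsupp m').
  rewrite domE (fsetUidPr _ _ _) ?fsub1set // => -[lt|ps]; left => /=.
    exact: leqW.
  by rewrite (perm_size ps) size_map.
have permE : perm_eq (i |` finsupp m')%fset (i :: finsupp m').
  apply: uniq_perm; rewrite /= ?fset_uniq ?im' // => j.
  by rewrite in_fset1U inE.
rewrite domE => -[lt|ps]; [left|right].
  by rewrite (perm_size permE).
rewrite perm_sym; apply: perm_trans (perm_map _ permE) _.
rewrite map_cons cmM expcmnE cmUU muln1 (eqP (etrans (cmE_eq0 _ _) im')) addn0.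
rewrite perm_cons perm_sym; apply: perm_trans ps _.
suff /eq_in_map -> : {in finsupp m', m' =1 mmul (expcmn (ucm i) k.+1) m'}.
  exact: perm_refl.
move=> j jm'; rewrite cmM expcmnE ucmE.
case: (eqVneq i j) => [ij|_]; last by rewrite muln0.
by rewrite ij jm' in im'.
Qed.

(** Degrees being equal, the rank grows when the number of parts drops. *)
Lemma power_mon_tri m l : fps_coef (power_mon m) (part_mon l) != 0 ->
  l = shape_mon m \/
  (sumn (shape_mon m) - size (shape_mon m) < sumn l - size l)%N.
Proof.
move=> pm; have := power_mon_hom pm; rewrite mdeg_part_mon => ->.
move: pm; rewrite mon_eval_shape; have := size_le_sumn (shape_mon m).
move: (shape_mon m) => l' l'_le.
have /andP[_ l'0] := partsP l'; move=> /(prod_power_sum_neq0 l'0).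
rewrite (perm_size (finsupp_part_mon l)) size_iota => -[lt|ps]; [right; lia|left].
apply: perm_eq_part; rewrite perm_sym; apply: perm_trans ps _.
apply: perm_trans (perm_map _ (finsupp_part_mon l)) _.
rewrite (eq_map (part_monE l)) -[X in perm_eq _ X](mkseq_nth 0%N) /mkseq.
exact: perm_refl.
Qed.

End PowerSumNum.

(** * The character polynomials form a basis *)

Section Characters.
Variable F : numFieldType.

Local Notation power_mon := (mon_eval (@scaled_power_sum F)).

Lemma power_mon_inj : injective (malg_lift power_mon).
Proof.
exact: triangular_lift_inj (can_inj shape_monK) (@power_mon_diag F)
  (@power_mon_tri F).
Qed.

Lemma power_mon_surj d f : symmetric_fps f -> homogeneous_fps d f ->
  exists P, malg_lift power_mon P = f.
Proof.
apply: (triangular_lift_surj (sh := shape_mon)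
  (rho := fun l => (sumn l - size l)%N)); last exact: power_mon_tri.
- by move=> l; exists (mult_mon l); apply: mult_monK.
- exact: power_mon_sym.
- exact: power_mon_hom.
- exact: power_mon_diag.
Qed.

Lemma schur_inj : injective (malg_lift (schur F)).
Proof.
apply: (triangular_lift_inj (sh := id)
  (rho := fun l => index_sum (part_mon l))) => //.
  by move=> l; rewrite schur_diag oner_eq0.
exact: schur_tri.
Qed.

Lemma schur_surj d f : symmetric_fps f -> homogeneous_fps d f ->
  exists v, malg_lift (schur F) v = f.
Proof.
apply: (triangular_lift_surj (sh := id) (rho := fun l => index_sum (part_mon l)));
  last exact: schur_tri.
- by move=> l; exists l.
- exact: schur_sym.
- exact: schur_hom.
- by move=> l; rewrite schur_diag oner_eq0.
Qed.

(** Existence comes from the symmetry of the Schur function, uniqueness from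
    the injectivity of the substitution. *)
Lemma character_polyP l : malg_lift power_mon (character_poly F l) = schur F l.
Proof.
have [P PE] := power_mon_surj (@schur_sym F l) (@schur_hom F l).
rewrite -[LHS](subst_poly_lift (@scaled_power_sum F)).
suff [] : unique (@is_character_poly F l) (character_poly F l) by [].
apply: (xgetPex 0 (P := [set Q | unique (@is_character_poly F l) Q])).
exists P; split; first by rewrite /is_character_poly subst_poly_lift.
move=> Q; rewrite /is_character_poly subst_poly_lift => QE.
by apply: power_mon_inj; rewrite PE QE.
Qed.

Definition character_map : {malg F[intpart]} -> xpoly F :=
  malg_lift (@character_poly F).

Lemma power_mon_character_map v :
  malg_lift power_mon (character_map v) = malg_lift (schur F) v.
Proof.
rewrite linear_malg_lift_comp; apply: eq_malg_lift => l; exact: character_polyP.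
Qed.

Lemma character_map_inj : injective character_map.
Proof.
by move=> u v uv; apply: schur_inj; rewrite -!power_mon_character_map uv.
Qed.

(** The power sum product of a monomial is a combination of Schur functions;
    the same combination of character polynomials is the monomial, as both
    have the same image under the injective substitution. *)
Lemma character_map_surj P : exists v, character_map v = P.
Proof.
have monE m : exists v, character_map v = << m >>.
  have [v vE] := schur_surj (@power_mon_sym F m) (@power_mon_hom F m).
  by exists v; apply: power_mon_inj; rewrite power_mon_character_map vE malg_lift1.
have {monE} [v vE] := choice monE.
exists (malg_lift v P).
rewrite /character_map linear_malg_lift_comp -[RHS]malg_lift_id.
by apply: eq_malg_lift => m; apply: vE.
Qed.

End Characters.

(** * Adding the charge *)

Section Charge.
Variables (F : nzRingType) (K H : choiceType).

Definition with_charge (h : H) : {malg F[K]} -> {malg F[(K * H)%type]} :=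
  malg_lift (fun k => << (k, h) >>).

Definition charge_part (h : H) : {malg F[(K * H)%type]} -> {malg F[K]} :=
  malg_lift (fun p => if p.2 == h then << p.1 >> else 0).

Lemma charge_partE h v k : (charge_part h v)@_k = v@_(k, h).
Proof.
rewrite {2}[v]monalgE /charge_part /malg_lift !raddf_sum /=.
apply: eq_bigr => -[k' h'] _ /=; rewrite mcoeffZ mcoeffU xpair_eqE.
have [_|_] := eqVneq h' h; rewrite ?mcoeff0 ?mulr0 ?andbF ?mulr0n //.
by rewrite mcoeffU mulrnAr mulr1 andbT.
Qed.

Lemma charge_part_eq0 v : (forall h, charge_part h v = 0) -> v = 0.
Proof.
move=> v0; apply/malgP => -[k h]; rewrite -charge_partE v0 !mcoeff0.
by [].
Qed.

Lemma with_chargeK h : cancel (with_charge h) (charge_part h).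
Proof.
move=> w; rewrite /charge_part linear_malg_lift_comp -[RHS]malg_lift_id.
by apply: eq_malg_lift => k /=; rewrite malg_lift1 /= eqxx.
Qed.

Lemma charge_part_neq h h' w : h' != h -> charge_part h (with_charge h' w) = 0.
Proof.
move=> h'h; rewrite /charge_part linear_malg_lift_comp /malg_lift big1 // => k _.
by rewrite /= malg_lift1 /= (negPf h'h) scaler0.
Qed.

End Charge.

Section ChargedMap.
Variables (F : nzRingType) (K L H : choiceType).
Variable chi : {linear {malg F[K]} -> {malg F[L]}}.
Hypotheses (chi_inj : injective chi) (chi_surj : forall P, exists v, chi v = P).

Definition charged_map : {malg F[(K * H)%type]} -> {malg F[(L * H)%type]} :=
  malg_lift (fun p => with_charge p.2 (chi << p.1 >>)).

Lemma charged_map_with_charge h w :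
  charged_map (with_charge h w) = with_charge h (chi w).
Proof.
rewrite /charged_map linear_malg_lift_comp [chi w]linear_malg_lift.
rewrite /with_charge linear_malg_lift_comp.
by apply: eq_malg_lift => k /=; rewrite malg_lift1.
Qed.

Lemma charge_part_charged_map h v :
  charge_part h (charged_map v) = chi (charge_part h v).
Proof.
rewrite /charge_part /charged_map linear_malg_lift_comp [RHS]linear_malg_lift_comp.
apply: eq_malg_lift => -[k h'] /=; rewrite -/(charge_part h _).
by case: eqVneq => [->|h'h]; rewrite ?with_chargeK // charge_part_neq // linear0.
Qed.

Lemma charged_map_inj : injective charged_map.
Proof.
apply: raddf_inj => v v0; apply: charge_part_eq0 => h.
apply: chi_inj; rewrite -charge_part_charged_map.
by rewrite (v0 : charged_map v = 0) [RHS]linear0 /charge_part linear0.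
Qed.

Lemma charged_map_surj w : exists v, charged_map v = w.
Proof.
have U (p : (L * H)%type) : exists v, charged_map v = << p >>.
  case: p => m h; have [v vE] := chi_surj << m >>.
  exists (with_charge h v).
  by rewrite charged_map_with_charge vE /with_charge malg_lift1.
have {U} [v vE] := choice U.
exists (malg_lift v w).
rewrite /charged_map linear_malg_lift_comp -[RHS]malg_lift_id.
by apply: eq_malg_lift => p; apply: vE.
Qed.

Lemma charged_map_bij : bijective charged_map.
Proof.
rewrite -setTT_bijective; split => // [? ? _ _|w _]; first exact: charged_map_inj.
by have [v <-] := charged_map_surj w; exists v.
Qed.

Lemma charged_map_set_bij h : set_bij (range (@with_charge F K H h))
  (range (@with_charge F L H h)) charged_map.
Proof.
split=> [_ [v _ <-]|v1 v2 _ _|_ [P _ <-]].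
- by rewrite charged_map_with_charge; exists (chi v).
- exact: charged_map_inj.
have [v <-] := chi_surj P.
by exists (with_charge h v); [exists v|rewrite charged_map_with_charge].
Qed.

End ChargedMap.

(** * The two Fock spaces *)

Section Fock.
Variable F : comNzRingType.

Lemma of_xpolyE (P : xpoly F) : of_xpoly P = with_charge (0 : int) P.
Proof.
rewrite /of_xpoly subst_poly_lift; apply: eq_malg_lift => m.
rewrite mon_eval_shape -[in RHS](shape_monK m) /mult_mon.
pose g (m : M) : bosonic F := << (m, 0 : int) >>.
have gM : {morph g : m1 m2 / mmul m1 m2 >-> m1 * m2}.
  by move=> m1 m2; rewrite /g addalgUM mulr1 /=; congr << _ >>; congr pair.
by rewrite -/(g _) (big_morph g gM (erefl : g mone = 1)).
Qed.

Lemma qpow_of_xpoly h (P : xpoly F) : qpow F h * of_xpoly P = with_charge h P.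
Proof.
rewrite of_xpolyE /with_charge /malg_lift mulr_sumr; apply: eq_bigr => m _.
rewrite -scalerAr /qpow addalgUM mulr1.
suff -> : ((mone : M, h) : (M * int)%type) + (m, 0) = (m, h) by [].
by transitivity (mmul mone m : M, h + 0); last by rewrite mul1m addr0.
Qed.

Lemma bosonic_chargeE h : @bosonic_charge F h = range (@with_charge F _ int h).
Proof.
by apply/seteqP; split=> w [P _ <-]; exists P; rewrite ?qpow_of_xpoly.
Qed.

Lemma fermionic_chargeE h : @fermionic_charge F h = range (@with_charge F _ int h).
Proof.
apply/seteqP; split=> [v [s ->]|_ [w _ <-]].
  exists (\sum_(x <- s) x.1 *: << x.2 >>) => //.
  rewrite /with_charge linear_sum; apply: eq_bigr => x _.
  by rewrite linearZ /= malg_lift1.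
exists [seq (w@_k, k) | k <- msupp w].
by rewrite big_map.
Qed.

End Fock.

Theorem proposition2p13 (R : realType) :
  exists sigma : {linear fermionic R[i] -> bosonic R[i]},
    [/\ forall (l : intpart) (h : int),
          sigma (ket R[i] l h) =
          qpow R[i] h * of_xpoly (character_poly R[i] l),
        bijective sigma &
        forall h : int,
          set_bij (@fermionic_charge R[i] h) (@bosonic_charge R[i] h) sigma].
Proof.
pose chi : {linear {malg R[i][intpart]} -> {malg R[i][{cmonom nat}]}} :=
  malg_lift (@character_poly R[i]).
have chi_inj : injective chi := @character_map_inj R[i].
have chi_surj : forall P, exists v, chi v = P := @character_map_surj R[i].
pose sigma : {linear fermionic R[i] -> bosonic R[i]} := @charged_map _ _ _ int chi.
exists sigma; split=> [l h||h].
- rewrite qpow_of_xpoly; apply: etrans (malg_lift1 _ _) _.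
  by congr with_charge; apply: malg_lift1.
- exact: charged_map_bij.
- by rewrite fermionic_chargeE bosonic_chargeE; apply: charged_map_set_bij.
Qed.
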